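(* Let $d\ge1$, $L_1,\dots,L_d\ge1$ be integers and $\Lambda=\{1,\dots,L_1\}\times\cdots\times\{1,\dots,L_d\}$. For the Edwards–Anderson model with independent standard Gaussian couplings, the quenched surface pressure with free boundary conditions satisfies $$T^{(\Phi)}_\Lambda\;=\;-\frac{|\partial\Lambda|}{4}\lim_{k\to\infty}\int_0^1\Big(1-\big\langle q_{\partial B(\Lambda)}\big\rangle^{(\Pi_{k\Lambda})}_t\Big)\,dt ,$$ and in particular $\tau^{(\Phi)}_{\partial\Lambda}:=T^{(\Phi)}_\Lambda/|\partial\Lambda|$ satisfies $$-\frac14\;\le\;\tau^{(\Phi)}_{\partial\Lambda}\;\le\;0 .$$
   Context: Notation. $|\Lambda|=\prod_i L_i$ and $|\partial\Lambda|=2\sum_{i=1}^d\prod_{j\ne i}L_j$ is the surface of $\Lambda$. Spin configurations are $\sigma\in\{-1,1\}^{\Lambda}$. $B(\Lambda)$ is the set of nearest-neighbour bonds $b=\{n,n'\}\subset\Lambda$, $|n-n'|=1$, and $\sigma_b=\sigma_n\sigma_{n'}$. $(J_b)$ are i.i.d. standard Gaussian variables, $\mathrm{Av}$ the Gaussian expectation. Free boundary conditions: $Z^{(\Phi)}_\Lambda(J)=\sum_\sigma\exp\big(\sum_{b\in B(\Lambda)}J_b\sigma_b\big)$, quenched pressure $P^{(\Phi)}_\Lambda=\mathrm{Av}\ln Z^{(\Phi)}_\Lambda(J)$. The infinite-volume pressure $p=\lim |\Lambda'|^{-1}\mathrm{Av}\ln Z_{\Lambda'}$ (limit as all sides of the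 box $\Lambda'$ tend to infinity) is known to exist and not to depend on the (free or periodic) boundary conditions. The quenched surface pressure is $T^{(\Phi)}_\Lambda=P^{(\Phi)}_\Lambda-p|\Lambda|$. Tori. For a box $M=\prod_i\{1,\dots,M_i\}$, the torus $\Pi_M=\mathbb Z^d/(M_1\mathbb Z\times\cdots\times M_d\mathbb Z)$ has sites $M$ and bonds $b=(n,i)$, $n\in M$, $i\in\{1,\dots,d\}$, joining $n$ to $n+e_i$ (coordinates taken modulo $M_i$ in $\{1,\dots,M_i\}$); $\sigma_b=\sigma_n\sigma_{n+e_i}$. Define $\partial B(\Lambda)=\{(n,i):n\in\Lambda,\ n_i=L_i\}$, the torus bonds of $\Pi_\Lambda$ not in $B(\Lambda)$. Magnification. For a positive integer $k$, $k\Lambda=\prod_i\{1,\dots,kL_i\}$, partitioned into $k^d$ disjoint translates $\Lambda_s$ of $\Lambda$ (with $\Lambda_1=\Lambda$). Let $\mathcal C_{\Pi_{k\Lambda}}$ be the set of bonds of the torus $\Pi_{k\Lambda}$ not joining two sites of the same $\Lambda_s$ (i.e. bonds $(n,i)$ with $n_i\in L_i\mathbb Z$). For $t\in[0,1]$ consider on $\Pi_{k\Lambda}$ the potential $U_t(\sigma)=\sum_{b}\sqrt{t_b}J_b\sigma_b$, sum over all bonds of $\Pi_{k\Lambda}$, with $t_b=t$ if $b\in\mathcal C_{\Pi_{k\Lambda}}$ and $t_b=1$ otherwise. Its Gibbs state on pairs of configurations (two replicas, same $J$) is $\omega_t(g)=\sum_{\sigma,\tau}g(\sigma,\tau)e^{U_t(\sigma)+U_t(\tau)}/(\sum_\sigma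 e^{U_t(\sigma)})^2$ and the quenched state is $\langle\cdot\rangle^{(\Pi_{k\Lambda})}_t=\mathrm{Av}\,\omega_t(\cdot)$. The boundary bond overlap is $q_{\partial B(\Lambda)}(\sigma,\tau)=|\partial B(\Lambda)|^{-1}\sum_{b\in\partial B(\Lambda)}\sigma_b\tau_b$, where $\partial B(\Lambda)$ is viewed as the set of bonds $(n,i)$ of $\Pi_{k\Lambda}$ with $n\in\Lambda$, $n_i=L_i$. *)

(* Defs.v *)
From HB Require Import structures.
From mathcomp Require Import all_boot all_order all_algebra.
From mathcomp Require Import all_classical all_reals all_analysis.
Set Implicit Arguments.
Unset Strict Implicit.
Unset Printing Implicit Defensive.
Import Order.TTheory GRing.Theory Num.Theory.
Import numFieldNormedType.Exports.
Local Open Scope classical_set_scope.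
Local Open Scope ring_scope.

(* Sites of the box M = prod_i {1..M_i}, coordinates shifted to 0-based:
   site n has n i : 'I_(M i), i.e. n_i in {0,...,M_i - 1}. *)
Definition site (d : nat) (M : 'I_d -> nat) := {dffun forall i : 'I_d, 'I_(M i)}.

Lemma site_pos (d : nat) (M : 'I_d -> nat) (n : site M) (j : 'I_d) : (0 < M j)%N.
Proof. exact: leq_ltn_trans (leq0n _) (ltn_ord (n j)). Qed.

Definition shift (d : nat) (M : 'I_d -> nat) (n : site M) (i : 'I_d) : site M :=
  [ffun j : 'I_d => Ordinal (ltn_pmod ((n j : nat) + (j == i)) (site_pos n j))].

(* torus bonds b = (n, i) joining n to n + e_i *)
Definition bond (d : nat) (M : 'I_d -> nat) := (site M * 'I_d)%type.

Definition conf (d : nat) (M : 'I_d -> nat) := {ffun site M -> bool}.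

Definition spin (R : realType) (b : bool) : R := if b then 1 else -1.

Definition sigb (R : realType) (d : nat) (M : 'I_d -> nat) (s : conf M)
  (b : bond M) : R := spin R (s b.1) * spin R (s (shift b.1 b.2)).

(* bonds of B(M) (free boundary): (n,i) with n_i + 1 <= M_i - 1 (0-based),
   i.e. the torus bonds not in \partial B(M) *)
Definition free_bond (d : nat) (M : 'I_d -> nat) (b : bond M) : bool :=
  ((b.1 b.2).+1 < M b.2)%N.

(* Gaussian expectation over i.i.d. standard Gaussians indexed by a finite
   type, as an iterated integral against the N(0,1) law. *)
Fixpoint avl (R : realType) (T : eqType) (s : seq T) (f : (T -> R) -> R)
  (J0 : T -> R) : R :=
  match s with
  | [::] => f J0
  | b :: s' => \int[normal_prob (0:R) 1]_x
                 avl s' f (fun c => if c == b then x else J0 c)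
  end.

Definition Av (R : realType) (T : finType) (f : (T -> R) -> R) : R :=
  avl (enum T) f (fun _ => 0).

Definition Zfree (R : realType) (d : nat) (M : 'I_d -> nat) (J : bond M -> R) : R :=
  \sum_(s : conf M) expR (\sum_(b : bond M | free_bond b) J b * sigb R s b).

Definition Pfree (R : realType) (d : nat) (M : 'I_d -> nat) : R :=
  Av (fun J : bond M -> R => ln (Zfree J)).

Definition vol (R : realType) (d : nat) (M : 'I_d -> nat) : R :=
  \prod_(i < d) (M i)%:R.

Definition surf (R : realType) (d : nat) (M : 'I_d -> nat) : R :=
  2 * \sum_(i < d) \prod_(j < d | j != i) (M j)%:R.

Definition is_inf_vol_pressure (R : realType) (d : nat) (p : R) : Prop :=
  forall e : R, 0 < e -> exists N : nat, forall M : 'I_d -> nat,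
    (forall i, (N <= M i)%N) -> `| Pfree R M / vol R M - p | < e.

Definition mag (d : nat) (k : nat) (L : 'I_d -> nat) : 'I_d -> nat :=
  fun i => (k * L i)%N.

(* bonds of C_{Pi_{k Lambda}}: (n,i) with n_i (1-based) in L_i Z *)
Definition cut_bond (d : nat) (k : nat) (L : 'I_d -> nat) (b : bond (mag k L)) : bool :=
  (((b.1 b.2).+1 %% L b.2) == 0)%N.

Definition Ut (R : realType) (d : nat) (k : nat) (L : 'I_d -> nat) (t : R)
  (J : bond (mag k L) -> R) (s : conf (mag k L)) : R :=
  \sum_(b : bond (mag k L))
     Num.sqrt (if cut_bond b then t else 1) * J b * sigb R s b.

Definition omega (R : realType) (d : nat) (k : nat) (L : 'I_d -> nat) (t : R)
  (J : bond (mag k L) -> R) (g : conf (mag k L) -> conf (mag k L) -> R) : R :=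
  (\sum_(s : conf (mag k L)) \sum_(tau : conf (mag k L))
      g s tau * expR (Ut t J s + Ut t J tau))
  / (\sum_(s : conf (mag k L)) expR (Ut t J s)) ^+ 2.

Definition qstate (R : realType) (d : nat) (k : nat) (L : 'I_d -> nat) (t : R)
  (g : conf (mag k L) -> conf (mag k L) -> R) : R :=
  Av (fun J : bond (mag k L) -> R => omega t J g).

(* \partial B(Lambda) viewed inside Pi_{k Lambda}: (n,i) with n in Lambda
   and n_i = L_i (1-based), i.e. L_i - 1 (0-based) *)
Definition bdry_bond (d : nat) (k : nat) (L : 'I_d -> nat) (b : bond (mag k L)) : bool :=
  [forall j : 'I_d, ((b.1 j : nat) < L j)%N] && ((b.1 b.2 : nat) == (L b.2).-1)%N.

Definition qbdry (R : realType) (d : nat) (k : nat) (L : 'I_d -> nat)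
  (s tau : conf (mag k L)) : R :=
  (\sum_(b : bond (mag k L) | bdry_bond b) sigb R s b * sigb R tau b)
  / #|[pred b : bond (mag k L) | bdry_bond b]|%:R.

Definition Iint (R : realType) (d : nat) (L : 'I_d -> nat) (k : nat) : R :=
  \int[lebesgue_measure]_(t in `[(0:R), 1]) (1 - qstate t (@qbdry R d k L)).

(* Main.v *)
(* Interpolate on the torus: give the bonds cut by the block decomposition the
   weight sqrt t, so that the blocks are independent at t = 0 and the torus is
   recovered at t = 1.  Gaussian integration by parts turns the derivative of
   the quenched pressure into half the sum over the cut bonds of one minus their
   quenched overlap; by translation invariance every block contributes the same
   amount.  Interpolating in this way between the free box and the torus of the
   same size shows that their pressures differ by at most a quarter of the
   surface, so that the torus pressure per volume also converges to p.

   In the variable u = sqrt t the pressure is obtained from the free energy,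
   which is convex, and its tangent lines give, after integration by parts,
   (v - u) k(u) <= P(v) - P(u) with k continuous; hence P' = k without any
   differentiation under the Gaussian integral. *)
From Pilot Require Import Defs.
From HB Require Import structures.
From mathcomp Require Import all_boot all_order all_algebra.
From mathcomp Require Import all_classical all_reals all_analysis.
From mathcomp Require Import measurable_realfun zify ring lra.
Import Order.TTheory GRing.Theory Num.Theory.
Import numFieldNormedType.Exports.
Local Open Scope classical_set_scope.
Local Open Scope ring_scope.
Set Implicit Arguments.
Unset Strict Implicit.
Unset Printing Implicit Defensive.

(** * One Gaussian variable *)

Section Gauss1.
Variable R : realType.
Local Notation gauss := (normal_prob (0 : R) 1).
Local Notation mu := (@lebesgue_measure R).
Local Notation pdf := (normal_pdf (0 : R) 1).
Local Notation E f := (Rintegral gauss setT f).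

(** [Av] is an iterated integral along an enumeration of the bonds, so the integrability of every
    partial integral and the order of integration have to be controlled. Pseudo-Lipschitz functions
    serve this purpose: [ln Z] and the bond means are Lipschitz in the couplings, and the integrands
    [J b * bond_mean] and [bond_mean ^+ 2] are products of two Lipschitz functions. The variable [u]
    is suggested by the square roots in [Ut]: the weighted couplings are affine in [u]. The factor
    [2 * u] in the derivative is then absorbed by the derivative of the square root, and at [t = 0]
    continuity is enough. The constant 1/4 is the 1/2 of [dpress] times another 1/2, because the
    surface counts each boundary bond twice. The comparison of free box and torus survives the limit
    because the surface of the magnified box grows like [(k+1)^(d-1)], while the number of blocks is
    [(k+1)^d]. *)

Lemma gauss_pdfE (x : R) : pdf x = normal_peak 1 * expR (- x ^+ 2 / 2).
Proof.
by rewrite normal_pdfE ?oner_eq0// /normal_fun subr0 expr1n.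
Qed.

Lemma gauss_dom : gauss `<< mu.
Proof. exact: normal_prob_dominates. Qed.

(** Both functions have the same integral over every measurable set. This replaces the abstract
    Radon-Nikodym derivative by the explicit density in the change of variables. *)
Lemma RN_gauss_ae :
  ae_eq mu setT (Radon_Nikodym (charge_of_finite_measure gauss) mu)
    (fun x => (pdf x)%:E).
Proof.
apply: integral_ae_eq => //=.
- by apply: Radon_Nikodym_integrable; exact: gauss_dom.
- by apply/measurable_EFinP; exact: measurable_normal_pdf.
- by move=> A _ mA; rewrite -Radon_Nikodym_integral //; exact: gauss_dom.
Qed.

Lemma ge0_integral_gauss (f : R -> \bar R) : (forall x, 0 <= f x)%E ->
  measurable_fun setT f ->
  (\int[gauss]_x f x = \int[mu]_x (f x * (pdf x)%:E))%E.
Proof.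
move=> f0 mf.
rewrite -(Radon_Nikodym_SigmaFinite.change_of_variables gauss_dom f0)//.
apply: ae_eq_integral => //.
- apply: emeasurable_funM => //; apply: (measurable_int mu).
  by apply: Radon_Nikodym_SigmaFinite.f_integrable; exact: gauss_dom.
- apply: emeasurable_funM => //.
  by apply/measurable_EFinP; exact: measurable_normal_pdf.
- apply: ae_eqe_mul2l.
  apply: (ae_eq_trans _ RN_gauss_ae).
  by apply: ae_eq_Radon_Nikodym_SigmaFinite => //; exact: gauss_dom.
Qed.

Lemma integral_gauss (f : R -> \bar R) : gauss.-integrable setT f ->
  (\int[gauss]_x f x = \int[mu]_x (f x * (pdf x)%:E))%E.
Proof.
move=> fi; rewrite -(Radon_Nikodym_change_of_variables gauss_dom)//.
have mf : measurable_fun setT f by exact: (measurable_int gauss).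
apply: ae_eq_integral => //.
- apply: emeasurable_funM => //; apply: (measurable_int mu).
  by apply: Radon_Nikodym_integrable; exact: gauss_dom.
- apply: emeasurable_funM => //.
  by apply/measurable_EFinP; exact: measurable_normal_pdf.
- by apply: ae_eqe_mul2l; exact: RN_gauss_ae.
Qed.

Lemma gauss_integrable_density (f : R -> R) : measurable_fun setT f ->
  gauss.-integrable setT (EFin \o f) <->
  mu.-integrable setT (fun x => (f x * pdf x)%:E).
Proof.
move=> mf.
have mfE : measurable_fun setT (EFin \o f) by exact/measurable_EFinP.
have mp : measurable_fun setT (fun x => (f x * pdf x)%:E).
  apply/measurable_EFinP; apply: measurable_funM => //.
  exact: measurable_normal_pdf.
have e : (\int[gauss]_x `|(EFin \o f) x| = \int[mu]_x `|(f x * pdf x)%:E|)%E.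
  rewrite ge0_integral_gauss//; last exact: measurableT_comp.
  apply: eq_integral => x _.
  by rewrite /= normrM (ger0_norm (normal_pdf_ge0 _ _ _)) EFinM.
by split => /integrableP[_ h]; apply/integrableP; split => //; rewrite ?e// -e.
Qed.

Lemma gauss_sqr_integrable : gauss.-integrable setT (fun x : R => (x ^+ 2)%:E).
Proof.
apply/gauss_integrable_density; first exact: measurable_funX.
have p2 : (2 : R) != 0 by rewrite pnatr_eq0.
(* The density with standard deviation 2 dominates: [x ^+ 2 <= 4 * (1 + 3 * x ^+ 2 / 8) <= 4 * expR
   (3 * x ^+ 2 / 8)], and 3/8 is the gap between the exponents 1/2 and 1/8. *)
pose C := (4 * normal_peak 1 / normal_peak 2 : R).
apply: (@le_integrable _ _ _ mu _ _ _ (fun x => (C%:E * (normal_pdf 0 2 x)%:E)%E)) => //.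
- apply/measurable_EFinP; apply: measurable_funM; first exact: measurable_funX.
  exact: measurable_normal_pdf.
- move=> x _; rewrite -EFinM !abse_EFin lee_fin; apply: le_trans (ler_norm _).
  rewrite ger0_norm; last by rewrite mulr_ge0 ?sqr_ge0 ?normal_pdf_ge0.
  rewrite gauss_pdfE normal_pdfE// /normal_fun subr0 /C.
  have -> : 4 * normal_peak 1 / normal_peak 2 *
     (normal_peak 2 * expR (- x ^+ 2 / (2 ^+ 2 *+ 2))) =
     normal_peak 1 * (4 * expR (- x ^+ 2 / (2 ^+ 2 *+ 2))) :> R.
    by field; rewrite gt_eqF// normal_peak_gt0.
  rewrite mulrCA ler_wpM2l ?normal_peak_ge0//.
  have -> : - x ^+ 2 / (2 ^+ 2 *+ 2) = - x ^+ 2 / 2 + 3 * x ^+ 2 / 8 by field.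
  rewrite expRD mulrCA [leLHS]mulrC ler_wpM2l ?expR_ge0//.
  have := expR_ge1Dx (3 * x ^+ 2 / 8); have := sqr_ge0 x; lra.
- by apply: integrableZl => //; exact: integrable_normal_pdf.
Qed.

(* Pseudo-Lipschitz functions: Gaussian-integrable, stable under partial
   integration, and containing the products of Lipschitz functions. *)
Definition PL1 (f : R -> R) :=
  exists C, forall x y, `|f x - f y| <= C * (1 + `|x| + `|y|) * `|x - y|.

Lemma PL1_continuous f : PL1 f -> continuous f.
Proof.
move=> [C hC] x.
apply/cvgrPdist_le => /= e e0.
have C0 : 0 <= C.
  have := le_trans (normr_ge0 _) (hC 1 0).
  by rewrite normr1 normr0 subr0 normr1; lra.
pose D := (C + 1) * (2 + 2 * `|x|).
have D0 : 0 < D by rewrite mulr_gt0//; have := normr_ge0 x; lra.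
near=> y.
have h1 : `|x - y| <= 1 by near: y; apply: cvgr_dist_le => //; exact: ltr01.
have h2 : `|x - y| <= e / D.
  by near: y; apply: cvgr_dist_le => //; rewrite divr_gt0.
apply: (le_trans (hC x y)).
have : `|y| <= `|x| + 1.
  have := ler_normB x (x - y); rewrite (_ : x - (x - y) = y); last by ring.
  lra.
move=> hy; apply: (@le_trans _ _ (D * `|x - y|)).
  by rewrite ler_wpM2r// /D ler_pM//; have := normr_ge0 x; have := normr_ge0 y; lra.
by rewrite mulrC -ler_pdivlMr.
Unshelve. all: by end_near. Qed.

Lemma continuous_sqr_bound_integrable (f : R -> R) C : continuous f ->
  (forall x, `|f x| <= C * (1 + x ^+ 2)) -> gauss.-integrable setT (EFin \o f).
Proof.
move=> cf hC.
apply: (@le_integrable _ _ _ gauss _ _ _ (fun x => (C%:E * ((cst 1%:E x) + (x ^+ 2)%:E))%E)) => //.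
- by apply/measurable_EFinP; exact: continuous_measurable_fun.
- move=> x _; rewrite -EFinD -EFinM !abse_EFin lee_fin.
  by apply: (le_trans (hC x)); exact: ler_norm.
- apply: integrableZl => //; apply: integrableD => //.
    exact: finite_measure_integrable_cst.
  exact: gauss_sqr_integrable.
Qed.

Lemma PL1_integrable f : PL1 f -> gauss.-integrable setT (EFin \o f).
Proof.
move=> pf; have cf := PL1_continuous pf; case: pf => C hC.
apply: (@continuous_sqr_bound_integrable _ (`|f 0| + 2 * `|C|)) => // x.
have := hC x 0; rewrite normr0 subr0 addr0 => h.
have h2 : `|f x| <= `|f 0| + `|f x - f 0|.
  by rewrite -{1}(subrK (f 0) (f x)) addrC ler_normD.
apply: (le_trans h2).
have h3 : C * (1 + `|x|) * `|x| <= `|C| * (2 * (1 + x ^+ 2)).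
  rewrite -mulrA; apply: (@le_trans _ _ (`|C| * ((1 + `|x|) * `|x|))).
    by rewrite ler_wpM2r ?ler_norm// mulr_ge0// addr_ge0.
  rewrite ler_wpM2l// -(real_normK (num_real x)).
  have := sqr_ge0 (`|x| - 1); have := sqr_ge0 (`|x|); nra.
have := normr_ge0 (f 0); have := sqr_ge0 x; nra.
Qed.

Lemma gaussT : gauss setT = 1%E.
Proof. exact: probability_setT. Qed.

Lemma E_cst (c : R) : E (fun=> c) = c.
Proof.
transitivity (c * fine (gauss setT)); first exact: Rintegral_cst.
by rewrite gaussT /= mulr1.
Qed.

Lemma PL1_E_EFin f : PL1 f -> (E f)%:E = (\int[gauss]_x (f x)%:E)%E.
Proof.
move=> pf; rewrite /Rintegral fineK//.
by apply: integrable_fin_num => //; exact: PL1_integrable.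
Qed.

Lemma PL1_norm : PL1 (fun x : R => `|x|).
Proof.
exists 1 => x y; rewrite mul1r; apply: (le_trans (ler_dist_dist x y)).
by rewrite ler_peMl// -addrA lerDl addr_ge0.
Qed.

Lemma PL1_cst c : PL1 (fun=> c : R).
Proof. by exists 0 => x y; rewrite subrr normr0 !mul0r. Qed.

Lemma PL1D f g : PL1 f -> PL1 g -> PL1 (fun x => f x + g x).
Proof.
move=> [C hC] [D hD]; exists (C + D) => x y.
rewrite opprD addrACA (le_trans (ler_normD _ _))//.
by have := hC x y; have := hD x y; rewrite !mulrDl; lra.
Qed.

Lemma PL1Z c f : PL1 f -> PL1 (fun x => c * f x).
Proof.
move=> [C hC]; exists (`|c| * C) => x y.
by rewrite -mulrBr normrM -!mulrA ler_wpM2l// mulrA hC.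
Qed.

Lemma E_D f g : PL1 f -> PL1 g -> E (fun x => f x + g x) = E f + E g.
Proof. by move=> pf pg; rewrite RintegralD//; exact: PL1_integrable. Qed.

Lemma E_Z c f : PL1 f -> E (fun x => c * f x) = c * E f.
Proof. by move=> pf; rewrite RintegralZl//; exact: PL1_integrable. Qed.

Lemma E_le f g : PL1 f -> PL1 g -> (forall x, f x <= g x) -> E f <= E g.
Proof. by move=> pf pg fg; apply: le_Rintegral => //; exact: PL1_integrable. Qed.

(** Rounding the first argument down to a multiple of [1/(n+1)] gives a function whose preimages are
    countable unions of measurable rectangles; continuity in the first argument makes these
    functions converge pointwise to [g]. *)
Lemma measurable_prod_continuous (g : R * R -> R) :
  (forall y, continuous (fun x => g (x, y))) ->
  (forall x, continuous (fun y => g (x, y))) ->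
  measurable_fun setT g.
Proof.
move=> g1 g2.
pose fl (n : nat) (x : R) : R := (Num.floor (n.+1%:R * x))%:~R / n.+1%:R.
apply: (@measurable_fun_cvg _ _ _ _ (fun n z => g (fl n z.1, z.2))).
- move=> n _ A mA; rewrite setTI.
  rewrite (_ : _ @^-1` A = \bigcup_(z : int)
     ((fun x : R => Num.floor (n.+1%:R * x)) @^-1` [set z] `*`
      ((fun y => g (z%:~R / n.+1%:R, y)) @^-1` A))); last first.
    apply/seteqP; split => [[x y]/= h|[x y]/= [z _ [/= zx]]].
      by exists (Num.floor (n.+1%:R * x)).
    by rewrite /fl zx.
  apply: countable_bigcupT_measurable => // z.
  apply: measurableX; last first.
    rewrite -[X in measurable X]setTI.
    exact: (continuous_measurable_fun (g2 (z%:~R / n.+1%:R))).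
  rewrite (_ : _ @^-1` _ = `[z%:~R / n.+1%:R, (z + 1)%:~R / n.+1%:R[%classic).
    exact: measurable_itv.
  apply/seteqP; split => x /=; rewrite in_itv/= ler_pdivrMr// ltr_pdivlMr//
    mulrC -floor_eq; first by move=> /eqP.
  by move/eqP.
- move=> [x y] _ /=.
  have hx : fl n x @[n --> \oo] --> x.
    apply/cvgrPdist_le => /= e e0.
    near=> n.
    apply: (@le_trans _ _ (n.+1%:R^-1)); last first.
      near: n; have /cvgrPdist_le/(_ _ e0) := @cvg_harmonic R.
      by apply: filterS => n; rewrite sub0r normrN ger0_norm// invr_ge0.
    rewrite /fl; have := floor_itv (n.+1%:R * x).
    set z : R := _%:~R; rewrite intrD /= -/z => /andP[h1 h2].
    have n0 : (0 : R) < n.+1%:R by rewrite ltr0n.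
    have -> : x - z / n.+1%:R = (n.+1%:R * x - z) / n.+1%:R.
      by field; rewrite gt_eqF// ltr0n.
    rewrite normrM [X in _ * X]gtr0_norm ?invr_gt0// ler_piMl ?invr_ge0 ?ler0n//.
    by rewrite ger0_norm ?subr_ge0//; lra.
  exact: (cvg_comp _ _ hx (g1 y x)).
Unshelve. all: by end_near. Qed.

Lemma PL1B f g : PL1 f -> PL1 g -> PL1 (fun x => f x - g x).
Proof.
move=> pf pg; have := PL1D pf (PL1Z (-1) pg).
by congr (PL1 _); apply/funext => x; rewrite mulN1r.
Qed.

Lemma PL1_abs f : PL1 f -> PL1 (fun x => `|f x|).
Proof.
by move=> [C hC]; exists C => x y; apply: le_trans (hC x y); exact: ler_dist_dist.
Qed.

Lemma E_B f g : PL1 f -> PL1 g -> E (fun x => f x - g x) = E f - E g.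
Proof. by move=> pf pg; rewrite RintegralB//; exact: PL1_integrable. Qed.

Lemma E_dist_le f g h : PL1 f -> PL1 g -> PL1 h ->
  (forall x, `|f x - g x| <= h x) -> `|E f - E g| <= E h.
Proof.
move=> pf pg ph fgh; rewrite -E_B//.
apply: (@le_trans _ _ (E (fun x => `|f x - g x|))).
  by apply: le_normr_Rintegral => //; apply: PL1_integrable; exact: PL1B.
by apply: E_le => //; apply: PL1_abs; exact: PL1B.
Qed.

Section two_variables.
Variables (f : R -> R -> R) (C : R).
Hypothesis hC : forall x x' y y', `|f x y - f x' y'| <=
    C * (1 + `|x| + `|x'| + `|y| + `|y'|) * (`|x - x'| + `|y - y'|).

Lemma PL1_left y : PL1 (fun x => f x y).
Proof.
exists (`|C| * (1 + 2 * `|y|)) => x x'; apply: (le_trans (hC _ _ _ _)).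
rewrite subrr normr0 addr0 ler_wpM2r// -mulrA.
apply: (@le_trans _ _ (`|C| * (1 + `|x| + `|x'| + `|y| + `|y|))).
  by rewrite ler_wpM2r ?ler_norm// !addr_ge0.
rewrite ler_wpM2l//.
have := normr_ge0 x; have := normr_ge0 x'; have := normr_ge0 y; nra.
Qed.

Lemma PL1_right x : PL1 (fun y => f x y).
Proof.
exists (`|C| * (1 + 2 * `|x|)) => y y'; apply: (le_trans (hC _ _ _ _)).
rewrite subrr normr0 add0r ler_wpM2r// -mulrA.
apply: (@le_trans _ _ (`|C| * (1 + `|x| + `|x| + `|y| + `|y'|))).
  by rewrite ler_wpM2r ?ler_norm// !addr_ge0.
rewrite ler_wpM2l//.
have := normr_ge0 x; have := normr_ge0 y; have := normr_ge0 y'; nra.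
Qed.

(** The integrated variable enters the bound only through [|y|], so integration replaces it by the
    first absolute moment [m], which goes into the new constant. *)
Lemma PL1_partial : PL1 (fun x => E (f x)).
Proof.
pose m := E (fun x => `|x|).
have m0 : 0 <= m by apply: Rintegral_ge0.
exists (`|C| * (1 + 2 * m)) => x x'.
pose c := `|C| * `|x - x'|.
have c0 : 0 <= c by rewrite mulr_ge0.
apply: (@le_trans _ _ (E (fun y => c * (1 + `|x| + `|x'|) + (2 * c) * `|y|))).
  apply: E_dist_le; try exact: PL1_right.
    by apply: PL1D; [exact: PL1_cst|apply: PL1Z; exact: PL1_norm].
  move=> y; apply: (le_trans (hC _ _ _ _)).
  rewrite subrr normr0 addr0 -mulrA.
  apply: (@le_trans _ _ (`|C| * ((1 + `|x| + `|x'| + `|y| + `|y|) * `|x - x'|))).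
    by rewrite ler_wpM2r ?ler_norm// mulr_ge0// !addr_ge0.
  by rewrite le_eqVlt /c; apply/orP; left; apply/eqP; ring.
rewrite E_D; [|exact: PL1_cst|by apply: PL1Z; exact: PL1_norm].
rewrite E_cst E_Z; last exact: PL1_norm.
rewrite -/m [leLHS](_ : _ = c * (1 + `|x| + `|x'| + 2 * m)); last by ring.
rewrite [leRHS](_ : _ = c * ((1 + 2 * m) * (1 + `|x| + `|x'|))); last first.
  by rewrite /c; ring.
rewrite ler_wpM2l//.
have := normr_ge0 x; have := normr_ge0 x'; nra.
Qed.

End two_variables.

Lemma E_swap (f : R -> R -> R) C :
  (forall x x' y y', `|f x y - f x' y'| <=
    C * (1 + `|x| + `|x'| + `|y| + `|y'|) * (`|x - x'| + `|y - y'|)) ->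
  E (fun x => E (fun y => f x y)) = E (fun y => E (fun x => f x y)).
Proof.
move=> hC; have p1 := PL1_left hC; have p2 := PL1_right hC.
have hC' y y' x x' : `|f x y - f x' y'| <=
    C * (1 + `|y| + `|y'| + `|x| + `|x'|) * (`|y - y'| + `|x - x'|).
  by apply: (le_trans (hC x x' y y')); rewrite le_eqVlt; apply/orP; left; apply/eqP; ring.
have hCa x x' y y' : `| `|f x y| - `|f x' y'| | <=
    C * (1 + `|x| + `|x'| + `|y| + `|y'|) * (`|x - x'| + `|y - y'|).
  by apply: le_trans (hC _ _ _ _); exact: ler_dist_dist.
have mf : measurable_fun setT (fun z : R * R => f z.1 z.2).
  by apply: measurable_prod_continuous => /= z; apply: PL1_continuous.
pose F (z : R * R) := (f z.1 z.2)%:E.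
have mF : measurable_fun setT F by exact/measurable_EFinP.
(* Integrability on the product is read off the iterated integral of [|f|]: it is finite because the
   inner integral is again pseudo-Lipschitz. *)
have iF : (gauss \x gauss)%E.-integrable setT F.
  apply/integrable12ltyP => //.
  have e x : (\int[gauss]_y `|F (x, y)| = (E (fun y => `|f x y|))%:E)%E.
    by rewrite (PL1_E_EFin (PL1_abs (p2 x))).
  under eq_integral do rewrite e.
  by rewrite -(PL1_E_EFin (PL1_partial hCa)) ltry.
apply: EFin_inj.
rewrite (PL1_E_EFin (PL1_partial hC)) (PL1_E_EFin (PL1_partial hC')).
under eq_integral do rewrite (PL1_E_EFin (p2 _)).
rewrite (Fubini iF).
by under [RHS]eq_integral do rewrite (PL1_E_EFin (p1 _)).
Qed.
End Gauss1.

(** * Gaussian integration by parts in one variable *)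

Section GaussIBP.
Variable R : realType.
Local Notation gauss := (normal_prob (0 : R) 1).
Local Notation mu := (@lebesgue_measure R).
Local Notation pdf := (normal_pdf (0 : R) 1).
Local Notation E f := (Rintegral gauss setT f).

Lemma is_derive_gauss_pdf (x : R) : is_derive x 1 pdf (- x * pdf x).
Proof.
have -> : pdf = (fun x => normal_peak 1 * expR (- x ^+ 2 / 2)).
  by apply/funext => y; rewrite gauss_pdfE.
apply: is_derive_eq.
rewrite /GRing.scale /=.
by field.
Qed.

(** A crude decay rate, sufficient to make the boundary terms of the integration by parts vanish
    when [G] is bounded. *)
Lemma gauss_pdf_le (n : nat) (x : R) : `|x| = n.+1%:R ->
  pdf x <= normal_peak 1 * 2 * n.+1%:R^-1.
Proof.
move=> xn; rewrite gauss_pdfE -mulrA ler_wpM2l ?normal_peak_ge0//.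
rewrite mulNr expRN ler_pdivlMr ?ltr0n// mulrC ler_pdivrMr ?expR_gt0//.
rewrite -ler_pdivrMl// (le_trans _ (expR_ge1Dx _))//.
rewrite -(real_normK (num_real x)) xn.
have := ler0n R n.+1; set m := n.+1%:R; move=> m0; have := sqr_ge0 (m - 1).
rewrite expr2; nra.
Qed.

(** The function [(G' x - x * G x) * pdf x] is the derivative of [G x * pdf x]. Its integral over
    [[-(n+1), n+1]] is a boundary term tending to 0, and by dominated convergence it also tends to
    the integral over the line. *)
Lemma gauss_ibp (G G' : R -> R) (C : R) : (forall x : R, is_derive x 1 G (G' x)) ->
  continuous G' -> (forall x, `|G x| <= C) -> (forall x, `|G' x| <= C) ->
  E (fun x => x * G x) = E G'.
Proof.
move=> dG cG' GC GC'.
have C0 : 0 <= C by rewrite (le_trans (normr_ge0 _) (GC 0)).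
have cG : continuous G.
  by move=> x; apply: differentiable_continuous; apply/derivable1_diffP.
have iG' : gauss.-integrable setT (EFin \o G').
  apply: (@continuous_sqr_bound_integrable _ _ C) => // x.
  by rewrite (le_trans (GC' x))// ler_peMr// lerDl sqr_ge0.
have cxG : continuous (fun x : R => x * G x).
  by move=> x; apply: cvgM => //; exact: cG.
have ixG : gauss.-integrable setT (EFin \o (fun x => x * G x)).
  apply: (@continuous_sqr_bound_integrable _ _ C) => // x.
  rewrite normrM mulrC ler_pM// -(real_normK (num_real x)).
  by have := sqr_ge0 (`|x| - 1); have := normr_ge0 x; nra.
pose f (x : R) := (G' x - x * G x) * pdf x.
have i : gauss.-integrable setT (EFin \o (fun x => G' x - x * G x)).
  by have := integrableB measurableT iG' ixG.
have cd : continuous (fun x : R => G' x - x * G x).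
  by move=> x; apply: cvgB; [exact: cG'|exact: cxG].
have iF : mu.-integrable setT (EFin \o f).
  by apply/gauss_integrable_density => //; exact: continuous_measurable_fun.
have cpdf : continuous pdf by apply: continuous_normal_pdf; rewrite oner_eq0.
have cf : continuous f by move=> x; apply: cvgM; [exact: cd|exact: cpdf].
suff : E (fun x => G' x - x * G x) = 0.
  by rewrite RintegralB// => /eqP; rewrite subr_eq0 => /eqP ->.
rewrite /Rintegral integral_gauss//.
have -> : (\int[mu]_x ((G' x - x * G x)%:E * (pdf x)%:E) = \int[mu]_x (f x)%:E)%E by [].
pose g n x := (f \_ `[- n.+1%:R, n.+1%:R]) x.
have dcv : (\int[mu]_x (g n x)%:E)%E @[n --> \oo] --> (\int[mu]_x (f x)%:E)%E.
  apply: (@dominated_cvg _ _ _ mu setT _ _ _ (fun x => `|(f x)%:E|%E)) => //.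
  - move=> n; apply/measurable_EFinP; apply/measurable_restrict => //.
    by rewrite setTI; apply: measurable_funTS; exact: continuous_measurable_fun.
  - move=> x _; apply: cvg_EFin; first exact: nearW.
    apply: cvg_near_cst; near=> n.
    rewrite /= /g patchE mem_set//= in_itv/= -ler_norml.
    rewrite ltW//; near: n; exists (Num.truncn `|x|) => // n /= hn.
    by rewrite (lt_le_trans (truncnS_gt _))// ler_nat ltnS.
  - exact: integrable_abse.
  - move=> n x _; rewrite lee_fin /g patchE; case: ifP => //.
    by rewrite normr0.
have gE n : (\int[mu]_x (g n x)%:E = ((G n.+1%:R * pdf n.+1%:R) - G (- n.+1%:R) * pdf (- n.+1%:R))%:E)%E.
  rewrite EFinB -(@continuous_FTC2 _ f (fun x => G x * pdf x)).
  - by rewrite [RHS]integral_mkcond; apply: eq_integral => x _; rewrite restrict_EFin.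
  - by rewrite ltrNl (lt_trans (_ : _ < 0))// ?oppr_lt0 ltr0n.
  - exact: continuous_subspaceT.
  - have dF (x : R) : is_derive x (1 : R) (fun x => G x * pdf x) (f x).
      have ? := is_derive_gauss_pdf x.
      by apply: is_derive_eq; rewrite /GRing.scale /= /f; ring.
    split=> [x _| |].
    - exact: ex_derive.
    - by apply: cvg_at_right_filter; apply: cvgM; [exact: cG|exact: cpdf].
    - by apply: cvg_at_left_filter; apply: cvgM; [exact: cG|exact: cpdf].
  - move=> x _; rewrite derive1E.
    have := is_derive_gauss_pdf x; move: (dG x) => ? ?.
    rewrite derive_val /GRing.scale /= /f; ring.
have l0 : (\int[mu]_x (g n x)%:E)%E @[n --> \oo] --> 0%E.
  under eq_fun do rewrite gE.
  apply: cvg_EFin; first exact: nearW.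
  apply/norm_cvg0P; pose K := C * (normal_peak 1 * 2) * 2 : R.
  apply: (@squeeze_cvgr _ _ _ _ (cst 0) (fun n => K * harmonic n)).
  - apply: nearW => n; rewrite normr_ge0/= (le_trans (ler_normB _ _))//.
    rewrite !normrM !(ger0_norm (normal_pdf_ge0 _ _ _)).
    rewrite (_ : K * _ = C * (normal_peak 1 * 2 * n.+1%:R^-1) +
       C * (normal_peak 1 * 2 * n.+1%:R^-1)); last by rewrite /K /=; ring.
    by rewrite lerD// ler_pM ?normal_pdf_ge0// gauss_pdf_le// ?normrN normr_nat.
  - exact: cvg_cst.
  - rewrite -[X in _ --> X](mulr0 K); apply: cvgM; first exact: cvg_cst.
    exact: cvg_harmonic.
by rewrite (cvg_unique _ dcv l0).
Unshelve. all: by end_near. Qed.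
End GaussIBP.

(** * Iterated Gaussian expectations *)

Section PseudoLipschitz.
Variables (R : realType) (T : finType).
Implicit Types (J : T -> R) (f g : (T -> R) -> R) (s : seq T).
Local Notation gauss := (normal_prob (0 : R) 1).
Local Notation E f := (Rintegral gauss setT f).

Definition nrm J : R := \sum_c `|J c|.
Definition upd J (b : T) (x : R) : T -> R := fun c => if c == b then x else J c.

Definition PL f := exists2 K, 0 <= K & forall J J',
  `|f J - f J'| <= K * (1 + nrm J + nrm J') * nrm (J - J').

Lemma nrm_ge0 J : 0 <= nrm J. Proof. exact: sumr_ge0. Qed.

Lemma nrm_coord J b : `|J b| <= nrm J.
Proof. by rewrite /nrm (bigD1 b)//= lerDl sumr_ge0. Qed.

Lemma nrm_upd J b x : nrm (upd J b x) <= nrm J + `|x|.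
Proof.
rewrite /nrm (bigD1 b)//= [X in _ <= X + _](bigD1 b)//= /upd eqxx addrC.
rewrite lerD2r (le_trans _ (_ : \sum_(i | i != b) `|J i| <= _)) ?lerDr//.
by apply: ler_sum => c /negbTE ->.
Qed.

Lemma nrm_updB J J' b x y : nrm (upd J b x - upd J' b y) <= nrm (J - J') + `|x - y|.
Proof.
rewrite (_ : upd J b x - upd J' b y = upd (J - J') b (x - y)) ?nrm_upd//.
by apply/funext => c; rewrite /upd !fctE; case: ifP.
Qed.

Lemma PL_upd2 f : PL f -> exists2 K, 0 <= K & forall J J' b x y,
  `|f (upd J b x) - f (upd J' b y)| <=
  K * (1 + nrm J + nrm J' + `|x| + `|y|) * (nrm (J - J') + `|x - y|).
Proof.
move=> [K K0 hK]; exists K => // J J' b x y; apply: (le_trans (hK _ _)).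
have := nrm_upd J b x; have := nrm_upd J' b y; have := nrm_ge0 (upd J b x).
have := nrm_ge0 (upd J' b y) => h1 h2 h3 h4.
apply: ler_pM => //; first by rewrite mulr_ge0//; lra.
- exact: nrm_ge0.
- by rewrite ler_wpM2l//; lra.
- exact: nrm_updB.
Qed.

Lemma PL_PL1 f J b : PL f -> PL1 (fun x => f (upd J b x)).
Proof.
move=> /PL_upd2[K K0 hK]; exists (K * (1 + 2 * nrm J)) => x y.
apply: (le_trans (hK J J b x y)).
rewrite subrr (_ : nrm 0 = 0) ?add0r; last first.
  by rewrite /nrm big1// => c _; rewrite normr0.
rewrite ler_wpM2r// -mulrA ler_wpM2l//.
have := nrm_ge0 J; have := normr_ge0 x; have := normr_ge0 y; nra.
Qed.

Lemma PL_integrate f b : PL f -> PL (fun J => E (fun x => f (upd J b x))).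
Proof.
move=> pf; have [K K0 hK] := PL_upd2 pf.
pose m := E (fun x => `|x|).
have m0 : 0 <= m by apply: Rintegral_ge0.
exists (K * (1 + 2 * m)); first by rewrite mulr_ge0//; lra.
move=> J J'; pose c := K * nrm (J - J').
have c0 : 0 <= c by rewrite mulr_ge0 ?nrm_ge0.
apply: (@le_trans _ _ (E (fun y => c * (1 + nrm J + nrm J') + (2 * c) * `|y|))).
  apply: E_dist_le; try exact: PL_PL1.
    by apply: PL1D; [exact: PL1_cst|apply: PL1Z; exact: PL1_norm].
  move=> y; apply: (le_trans (hK _ _ _ _ _)).
  by rewrite subrr normr0 addr0 le_eqVlt /c; apply/orP; left; apply/eqP; ring.
rewrite E_D; [|exact: PL1_cst|by apply: PL1Z; exact: PL1_norm].
rewrite E_cst E_Z; last exact: PL1_norm.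
rewrite -/m [leLHS](_ : _ = c * (1 + nrm J + nrm J' + 2 * m)); last by ring.
rewrite [leRHS](_ : _ = c * ((1 + 2 * m) * (1 + nrm J + nrm J'))); last first.
  by rewrite /c; ring.
rewrite ler_wpM2l//.
have := nrm_ge0 J; have := nrm_ge0 J'; nra.
Qed.

Lemma avl_cons b s f J : avl (b :: s) f J = E (fun x => avl s f (upd J b x)).
Proof. by []. Qed.

Lemma PL_avl s f : PL f -> PL (avl s f).
Proof. by elim: s f => //= b s IH f pf; apply: PL_integrate; exact: IH. Qed.

Lemma avl_cat s1 s2 f J : avl (s1 ++ s2) f J = avl s1 (avl s2 f) J.
Proof.
elim: s1 J => //= b s1 IH J.
by under eq_Rintegral do rewrite IH.
Qed.

Lemma eq_avl s f g J : f =1 g -> avl s f J = avl s g J.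
Proof.
by move=> fg; elim: s J => //= b s IH J; under eq_Rintegral do rewrite IH.
Qed.

(** Fubini for two neighbouring coordinates: after the remaining ones are integrated out, the
    function is still pseudo-Lipschitz in these two, and overwriting distinct coordinates
    commutes. *)
Lemma avl_swap b c s f J : PL f -> avl (b :: c :: s) f J = avl (c :: b :: s) f J.
Proof.
move=> pf; have [->//|bc] := eqVneq b c.
rewrite !avl_cons.
under eq_Rintegral do rewrite avl_cons.
under [RHS]eq_Rintegral do rewrite avl_cons.
have [K K0 hK] := PL_avl s pf.
rewrite (@E_swap _ _ (K * (1 + 2 * nrm J))).
  apply: eq_Rintegral => x _; apply: eq_Rintegral => y _; congr avl.
  by apply/funext => d; rewrite /upd; case: eqP => // ->; rewrite (negbTE (_ : _ != _))// eq_sym.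
move=> x x' y y'; apply: (le_trans (hK _ _)).
apply: ler_pM; rewrite ?mulr_ge0 ?addr_ge0 ?nrm_ge0//.
- rewrite -mulrA ler_wpM2l//.
  have := nrm_upd J b x; have := nrm_upd J b x'.
  have := nrm_upd (upd J b x) c y; have := nrm_upd (upd J b x') c y'.
  have := nrm_ge0 J; have := normr_ge0 x; have := normr_ge0 y.
  have := normr_ge0 x'; have := normr_ge0 y'; nra.
- apply: (le_trans (nrm_updB _ _ _ _ _)); rewrite lerD2r.
  apply: (le_trans (nrm_updB _ _ _ _ _)); rewrite subrr.
  by rewrite (_ : nrm 0 = 0) ?add0r// /nrm big1// => d _; rewrite normr0.
Qed.

Lemma avl_perm s s' f J : PL f -> perm_eq s s' -> avl s f J = avl s' f J.
Proof.
move=> pf; have mid s1 s2 b J0 : avl (s1 ++ b :: s2) f J0 = avl (b :: s1 ++ s2) f J0.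
  elim: s1 J0 => //= c s1 IH J0.
  by under eq_Rintegral do rewrite IH; exact: avl_swap.
elim: s s' J => [|b s IH] s' J; first by rewrite perm_sym => /perm_nilP ->.
move=> ss'; have bs' : b \in s' by rewrite -(perm_mem ss') mem_head.
case/splitPr: bs' ss' => s1 s2 ss'; rewrite mid !avl_cons.
apply: eq_Rintegral => x _; apply: IH.
rewrite -(perm_cons b) (perm_trans ss')// perm_catC /= perm_cons.
by rewrite perm_catC.
Qed.

Lemma PL_cst (c : R) : PL (fun=> c).
Proof. by exists 0 => // J J'; rewrite subrr normr0 !mul0r. Qed.

Lemma PL_add f g : PL f -> PL g -> PL (fun J => f J + g J).
Proof.
move=> [K K0 hK] [K' K0' hK']; exists (K + K'); first exact: addr_ge0.
move=> J J'; rewrite opprD addrACA (le_trans (ler_normD _ _))//.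
by have := hK J J'; have := hK' J J'; rewrite !mulrDl; lra.
Qed.

Lemma PL_scale c f : PL f -> PL (fun J => c * f J).
Proof.
move=> [K K0 hK]; exists (`|c| * K); first exact: mulr_ge0.
by move=> J J'; rewrite -mulrBr normrM -!mulrA ler_wpM2l// mulrA hK.
Qed.

Lemma PL_opp f : PL f -> PL (fun J => - f J).
Proof.
move=> [K K0 hK]; exists K => // J J'.
by rewrite -opprD normrN; exact: hK.
Qed.

Lemma PL_sum (I : Type) (r : seq I) (P : pred I) (F : I -> (T -> R) -> R) :
  (forall i, P i -> PL (F i)) -> PL (fun J => \sum_(i <- r | P i) F i J).
Proof.
move=> pF; elim: r => [|i r IH].
  by under eq_fun do rewrite big_nil; exact: PL_cst.
have [Pi|Pi] := boolP (P i).
  by under eq_fun do rewrite big_cons Pi; apply: PL_add => //; exact: pF.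
by under eq_fun do rewrite big_cons (negbTE Pi).
Qed.

(** The smaller class is kept because products are controlled only for its members: two Lipschitz
    factors of linear growth give a function in [PL]. *)
Definition Lip f := exists2 K, 0 <= K & forall J J', `|f J - f J'| <= K * nrm (J - J').

Lemma Lip_PL f : Lip f -> PL f.
Proof.
move=> [K K0 hK]; exists K => // J J'; apply: (le_trans (hK _ _)).
rewrite ler_wpM2r ?nrm_ge0// ler_peMr//.
by have := nrm_ge0 J; have := nrm_ge0 J'; lra.
Qed.

Lemma Lip_growth f : Lip f -> exists2 K, 0 <= K & forall J, `|f J| <= K * (1 + nrm J).
Proof.
move=> [K K0 hK]; exists (K + `|f (cst 0)|); first exact: addr_ge0.
move=> J; have := hK J (cst 0).
rewrite (_ : J - cst 0 = J); last by apply/funext => c; rewrite !fctE subr0.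
have := ler_normD (f J - f (cst 0)) (f (cst 0)); rewrite subrK.
have := nrm_ge0 J; have := normr_ge0 (f (cst 0)); nra.
Qed.

Lemma PL_mul f g : Lip f -> Lip g -> PL (fun J => f J * g J).
Proof.
move=> lf lg; have [A A0 hA] := Lip_growth lf; have [B B0 hB] := Lip_growth lg.
case: lf lg => [K K0 hK] [K' K0' hK'].
exists (A * K' + B * K); first by rewrite addr_ge0 ?mulr_ge0.
move=> J J'.
rewrite (_ : _ - _ = f J * (g J - g J') + g J' * (f J - f J')); last by ring.
rewrite (le_trans (ler_normD _ _))// !normrM !mulrDl; apply: lerD.
  apply: (@le_trans _ _ (A * (1 + nrm J) * (K' * nrm (J - J')))).
    by rewrite ler_pM.
  rewrite [leLHS](_ : _ = A * K' * nrm (J - J') * (1 + nrm J)); last by ring.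
  rewrite [leRHS](_ : _ = A * K' * nrm (J - J') * (1 + nrm J + nrm J')); last by ring.
  by rewrite ler_wpM2l ?mulr_ge0 ?nrm_ge0// lerDl nrm_ge0.
apply: (@le_trans _ _ (B * (1 + nrm J') * (K * nrm (J - J')))).
  by rewrite ler_pM.
rewrite [leLHS](_ : _ = B * K * nrm (J - J') * (1 + nrm J')); last by ring.
rewrite [leRHS](_ : _ = B * K * nrm (J - J') * (1 + nrm J + nrm J')); last by ring.
by rewrite ler_wpM2l ?mulr_ge0 ?nrm_ge0//; have := nrm_ge0 J; lra.
Qed.

Lemma Lip_coord b : Lip (fun J => J b).
Proof. by exists 1 => // J J'; rewrite mul1r (nrm_coord (J - J')). Qed.

Lemma Lip_nrm : Lip nrm.
Proof.
exists 1 => // J J'; rewrite mul1r /nrm -sumrB (le_trans (ler_norm_sum _ _ _))//.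
by apply: ler_sum => c _; rewrite !fctE ler_dist_dist.
Qed.

Lemma avl_lin s f g c J : PL f -> PL g ->
  avl s (fun J => f J + c * g J) J = avl s f J + c * avl s g J.
Proof.
move=> pf pg; elim: s J => //= b s IH J; under eq_Rintegral do rewrite IH.
rewrite E_D; last 2 first.
- by apply: (@PL_PL1 (avl s f)); exact: PL_avl.
- by apply: PL1Z; apply: (@PL_PL1 (avl s g)); exact: PL_avl.
by rewrite E_Z//; apply: (@PL_PL1 (avl s g)); exact: PL_avl.
Qed.

Lemma avl_cst s c J : avl s (fun=> c : R) J = c.
Proof. by elim: s J => //= b s IH J; under eq_Rintegral do rewrite IH; exact: E_cst. Qed.

Lemma avl_le s f g J : PL f -> PL g -> (forall J, f J <= g J) -> avl s f J <= avl s g J.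
Proof.
move=> pf pg fg; elim: s J => //= b s IH J.
by apply: E_le => //; [apply: (@PL_PL1 (avl s f))|apply: (@PL_PL1 (avl s g))];
  exact: PL_avl.
Qed.

Lemma Av_eq f g : f =1 g -> Av f = Av g.
Proof. exact: eq_avl. Qed.

Lemma Av_lin f g c : PL f -> PL g -> Av (fun J => f J + c * g J) = Av f + c * Av g.
Proof. exact: avl_lin. Qed.

Lemma Av_cst c : Av (fun _ : T -> R => c) = c.
Proof. exact: avl_cst. Qed.

Lemma Av_le f g : PL f -> PL g -> (forall J, f J <= g J) -> Av f <= Av g.
Proof. exact: avl_le. Qed.

Lemma Av_scale f c : PL f -> Av (fun J => c * f J) = c * Av f.
Proof.
move=> pf; have := @Av_lin (fun=> 0) f c (PL_cst 0) pf.
by rewrite Av_cst add0r => <-; apply: Av_eq => J; rewrite add0r.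
Qed.

Lemma Av_add f g : PL f -> PL g -> Av (fun J => f J + g J) = Av f + Av g.
Proof.
by move=> pf pg; rewrite -[Av g]mul1r -Av_lin//; apply: Av_eq => J; rewrite mul1r.
Qed.

Lemma Av_sub f g : PL f -> PL g -> Av (fun J => f J - g J) = Av f - Av g.
Proof.
by move=> pf pg; rewrite -mulN1r -Av_lin//; apply: Av_eq => J; rewrite mulN1r.
Qed.

Lemma Av_sum (I : Type) (r : seq I) (P : pred I) (F : I -> (T -> R) -> R) :
  (forall i, P i -> PL (F i)) ->
  Av (fun J => \sum_(i <- r | P i) F i J) = \sum_(i <- r | P i) Av (F i).
Proof.
move=> pF; elim: r => [|i r IH].
  by rewrite big_nil -[RHS]Av_cst; apply: Av_eq => J; rewrite big_nil.
rewrite big_cons; have [Pi|Pi] := boolP (P i).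
  rewrite -IH -Av_add; [|exact: pF|exact: PL_sum].
  by apply: Av_eq => J; rewrite big_cons Pi.
by rewrite -IH; apply: Av_eq => J; rewrite big_cons (negbTE Pi).
Qed.

Lemma Av_dist_le f g h : PL f -> PL g -> PL h ->
  (forall J, `|f J - g J| <= h J) -> `|Av f - Av g| <= Av h.
Proof.
move=> pf pg ph fgh; rewrite -Av_sub// ler_norml; apply/andP; split.
- rewrite -mulN1r -Av_scale//; apply: Av_le; [exact: PL_scale| |].
    by apply: PL_add => //; exact: PL_opp.
  by move=> J; rewrite mulN1r; have := fgh J; rewrite ler_norml => /andP[].
- apply: Av_le => //; first by apply: PL_add => //; exact: PL_opp.
  by move=> J; have := fgh J; rewrite ler_norml => /andP[].
Qed.

(* By Fubini the coordinate [b] can be integrated innermost. *)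
Lemma Av_partial f g b : PL f -> PL g ->
  (forall J, E (fun x => f (upd J b x)) = E (fun x => g (upd J b x))) -> Av f = Av g.
Proof.
move=> pf pg fg; have p : perm_eq (enum T) (rem b (enum T) ++ [:: b]).
  by rewrite perm_sym perm_catC /= perm_sym perm_to_rem ?mem_enum.
rewrite /Av (avl_perm _ pf p) (avl_perm _ pg p) !avl_cat.
by apply: eq_avl => J; exact: fg.
Qed.

Lemma avl_local (A : pred T) s f J J' : (forall J J', {in A, J =1 J'} -> f J = f J') ->
  {in A, J =1 J'} -> avl s f J = avl s f J'.
Proof.
move=> fA; elim: s J J' => [|b s IH] J J' JJ' /=; first exact: fA.
apply: eq_Rintegral => x _; apply: IH => c cA /=.
by case: ifP => // _; exact: JJ'.
Qed.

(** Integrating over a coordinate that [f] does not see only contributes the total mass 1. *)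
Lemma avl_filter (A : pred T) s f J : (forall J J', {in A, J =1 J'} -> f J = f J') ->
  avl s f J = avl (seq.filter A s) f J.
Proof.
move=> fA; elim: s J => //= b s IH J; case: ifPn => [bA|bA] /=.
  by apply: eq_Rintegral => x _; exact: IH.
rewrite -IH -[RHS](E_cst (avl s f J)); apply: eq_Rintegral => x _.
apply: (avl_local s fA) => c cA /=; case: eqP => // cb.
by move: bA; rewrite -cb (_ : A c).
Qed.

End PseudoLipschitz.

(** * Invariance of the Gaussian expectation under injective reindexing *)

Section Reindex.
Variables (R : realType) (T T' : finType) (iota : T -> T').
Hypothesis iota_inj : injective iota.

Lemma nrm_comp (J : T' -> R) : nrm (J \o iota) <= nrm J.
Proof.
rewrite /nrm -(big_map iota xpredT (fun c => `|J c|)).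
rewrite [leRHS](bigID (mem (map iota (index_enum T)))) /=.
rewrite -[X in _ <= X + _]big_filter [X in _ <= X + _](perm_big (map iota (index_enum T))) /=.
  by rewrite lerDl sumr_ge0.
apply: uniq_perm; rewrite ?filter_uniq ?index_enum_uniq ?map_inj_uniq ?index_enum_uniq//.
by move=> c; rewrite mem_filter mem_index_enum andbT.
Qed.

Lemma PL_comp (f : (T -> R) -> R) : PL f -> PL (fun J : T' -> R => f (J \o iota)).
Proof.
move=> [K K0 hK]; exists K => // J J'; apply: (le_trans (hK _ _)).
have := nrm_comp J; have := nrm_comp J'; have := nrm_comp (J - J').
have := nrm_ge0 (J \o iota); have := nrm_ge0 (J' \o iota).
have := nrm_ge0 ((J - J') \o iota) => h1 h2 h3 h4 h5 h6.
apply: ler_pM => //; first by rewrite mulr_ge0//; lra.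
by rewrite ler_wpM2l//; lra.
Qed.

Lemma avl_map s (f : (T -> R) -> R) (J : T' -> R) :
  avl (map iota s) (fun J => f (J \o iota)) J = avl s f (J \o iota).
Proof.
elim: s J => //= b s IH J; apply: eq_Rintegral => x _; rewrite IH.
by congr avl; apply/funext => c /=; rewrite inj_eq.
Qed.

(** Coordinates outside the image of [iota] integrate to 1, and the others can be reordered and
    renamed. This is used both for restricting the couplings to a block and for translating them on
    the torus. *)
Lemma Av_reindex (f : (T -> R) -> R) : PL f ->
  Av (fun J : T' -> R => f (J \o iota)) = Av f.
Proof.
move=> pf; rewrite /Av (@avl_filter _ _ (mem (map iota (enum T)))); last first.
  move=> J J' JJ'; congr f; apply/funext => c /=; apply: JJ'.
  by rewrite inE map_f// mem_enum.
rewrite (@avl_perm _ _ _ (map iota (enum T))); last 2 first.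
- exact: PL_comp.
- apply: uniq_perm; first exact/filter_uniq/enum_uniq.
    by rewrite map_inj_uniq ?enum_uniq.
  by move=> c; rewrite mem_filter mem_enum andbT.
by rewrite avl_map.
Qed.

End Reindex.

(** * Gibbs measures *)

Section Gibbs.
Variables (R : realType) (S B : finType) (h : S -> B -> R) (s0 : S).
Hypothesis h2 : forall s b, h s b ^+ 2 = 1.
Local Notation E f := (Rintegral (normal_prob (0 : R) 1) setT f).
Implicit Types (y J a : B -> R) (b : B) (s : S).

(** States and bonds are abstract, with observables [h s b] of square 1, so that one argument covers
    the free box and the torus. *)
Definition pot y s := \sum_b y b * h s b.
Definition pfun y := \sum_s expR (pot y s).
Definition bond_mean b y := (\sum_s h s b * expR (pot y s)) / pfun y.
Definition scale a J : B -> R := fun b => a b * J b.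

Lemma h_norm s b : `|h s b| = 1.
Proof. by apply/eqP; rewrite -(@eqrXn2 _ 2)// real_normK ?num_real// h2 expr1n. Qed.

Lemma pfun_gt0 y : 0 < pfun y.
Proof.
rewrite /pfun (bigD1 s0)//= ltr_wpDr ?expR_gt0//.
by apply: sumr_ge0 => s _; exact: expR_ge0.
Qed.

Lemma potB y y' s : pot (y' - y) s = pot y' s - pot y s.
Proof. by rewrite /pot -sumrB; apply: eq_bigr => b _; rewrite !fctE mulrBl. Qed.

Lemma pot_norm y s : `|pot y s| <= nrm y.
Proof.
rewrite (le_trans (ler_norm_sum _ _ _))//; apply: ler_sum => b _.
by rewrite normrM h_norm mulr1.
Qed.

Lemma bond_mean_norm b y : `|bond_mean b y| <= 1.
Proof.
rewrite normrM [X in _ * X]ger0_norm ?invr_ge0 ?(ltW (pfun_gt0 y))//.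
rewrite ler_pdivrMr ?pfun_gt0// mul1r (le_trans (ler_norm_sum _ _ _))//.
by apply: ler_sum => s _; rewrite normrM h_norm mul1r ger0_norm ?expR_ge0.
Qed.

(* The free energy is convex with gradient [bond_mean]; the tangent-line bound is
   Jensen's inequality for the Gibbs measure. *)
Lemma ln_pfun_subgrad y y' :
  \sum_b bond_mean b y * (y' b - y b) <= ln (pfun y') - ln (pfun y).
Proof.
set c := \sum_b _.
have cE : c * pfun y = \sum_s pot (y' - y) s * expR (pot y s).
  rewrite /c mulr_suml.
  under eq_bigr do rewrite mulrAC /bond_mean divfK ?gt_eqF ?pfun_gt0// mulr_suml.
  rewrite exchange_big /=; apply: eq_bigr => s _.
  by rewrite /pot mulr_suml; apply: eq_bigr => b _; rewrite !fctE; ring.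
rewrite lerBrDr -[c]expRK -lnM ?posrE ?expR_gt0 ?pfun_gt0//.
rewrite ler_ln ?posrE ?mulr_gt0 ?expR_gt0 ?pfun_gt0//.
apply: (@le_trans _ _ (\sum_s expR c * ((1 + (pot (y' - y) s - c)) * expR (pot y s)))).
  rewrite -mulr_sumr le_eqVlt; apply/orP; left; apply/eqP; congr (_ * _).
  under [RHS]eq_bigr do rewrite mulrDl mul1r mulrBl.
  by rewrite big_split sumrB /= -cE -mulr_sumr -/(pfun y) subrr addr0.
apply: ler_sum => s _.
have -> : expR (pot y' s) = expR c * (expR (pot (y' - y) s - c) * expR (pot y s)).
  by rewrite -!expRD; congr expR; rewrite potB; ring.
rewrite ler_wpM2l ?expR_ge0// ler_wpM2r ?expR_ge0//; exact: expR_ge1Dx.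
Qed.

Lemma ln_pfun_lip y y' : `|ln (pfun y) - ln (pfun y')| <= nrm (y - y').
Proof.
have H z z' : - nrm (y - y') <= \sum_b bond_mean b z * (z' b - z b) -> 
  ln (pfun z) - ln (pfun z') <= nrm (y - y').
  by move=> hz; have := ln_pfun_subgrad z z'; lra.
have H2 z z' : nrm (z' - z) = nrm (y - y') ->
    - nrm (y - y') <= \sum_b bond_mean b z * (z' b - z b).
  move=> <-; rewrite -[X in _ <= X]opprK lerN2 -sumrN; apply: ler_sum => b _.
  rewrite !fctE (le_trans (ler_norm _))// normrN normrM ler_piMl//.
  exact: bond_mean_norm.
have nC : nrm (y' - y) = nrm (y - y').
  by apply: eq_bigr => b _; rewrite !fctE distrC.
rewrite ler_norml lerNl opprB; apply/andP; split; apply: H; exact: H2.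
Qed.

(** Write the mean as [2 * p - 1], with [p] the Gibbs probability of [h s b = 1]. A change of
    potential of norm [D] alters each Boltzmann weight by a factor at most [expR D], hence [p] by at
    most [expR (2 * D)]; since [p <= 1], it moves by at most [2 * D]. *)
Lemma bond_mean_lip b y y' : `|bond_mean b y - bond_mean b y'| <= 4 * nrm (y - y').
Proof.
pose A y := \sum_s (1 + h s b) / 2 * expR (pot y s).
have c0 s : 0 <= (1 + h s b) / 2.
  by have := h_norm s b; have := ler_norm (- h s b); rewrite normrN; lra.
have c1 s : (1 + h s b) / 2 <= 1.
  by have := h_norm s b; have := ler_norm (h s b); lra.
have mE z : bond_mean b z = 2 * (A z / pfun z) - 1.
  have Z0 := pfun_gt0 z; rewrite /bond_mean.
  have -> : \sum_s h s b * expR (pot z s) = 2 * A z - pfun z.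
    rewrite /A /pfun mulr_sumr -sumrB; apply: eq_bigr => s _; by field.
  by field; rewrite gt_eqF.
have nC z z' : nrm (z' - z) = nrm (z - z').
  by apply: eq_bigr => c _; rewrite !fctE distrC.
have wle z z' s : expR (pot z' s) <= expR (nrm (z - z')) * expR (pot z s).
  rewrite -expRD ler_expR -lerBlDr -potB -nC.
  exact: le_trans (ler_norm _) (pot_norm _ _).
have half z z' : A z' / pfun z' - A z / pfun z <= 2 * nrm (z - z').
  set D := nrm _; set p' := A z' / _; set p := A z / _.
  have p'1 : p' <= 1.
    rewrite ler_pdivrMr ?pfun_gt0// mul1r; apply: ler_sum => s _.
    by rewrite ler_piMl ?expR_ge0.
  have p'0 : 0 <= p'.
    by rewrite divr_ge0 ?(ltW (pfun_gt0 _))//; apply: sumr_ge0 => s _; rewrite mulr_ge0 ?expR_ge0.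
  have pp : expR (- (2 * D)) * p' <= p.
    rewrite expRN mulrC ler_pdivrMr ?expR_gt0//.
    have AA : A z' <= expR D * A z.
      rewrite mulr_sumr; apply: ler_sum => s _.
      by rewrite mulrCA ler_wpM2l// wle.
    have ZZ : pfun z <= expR D * pfun z'.
      rewrite mulr_sumr; apply: ler_sum => s _.
      by rewrite (le_trans (wle z' z s))// nC.
    rewrite ler_pdivrMr ?pfun_gt0// /p mulrAC -mulrA mulrAC ler_pdivlMr ?pfun_gt0//.
    apply: (@le_trans _ _ (expR D * A z * (expR D * pfun z'))).
      by rewrite ler_pM ?(ltW (pfun_gt0 _))// sumr_ge0// => s _; rewrite mulr_ge0 ?expR_ge0.
    by rewrite mulr2n mulrDl mul1r expRD le_eqVlt; apply/orP; left; apply/eqP; ring.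
  have := expR_ge1Dx (- (2 * D)); have := nrm_ge0 (z - z'); rewrite -/D; nra.
rewrite !mE ler_norml; have := half y y'; have := half y' y; rewrite nC; lra.
Qed.

Lemma nrm_scale a J : nrm (scale a J) <= nrm a * nrm J.
Proof.
rewrite /nrm mulr_suml; apply: ler_sum => b _.
by rewrite normrM ler_wpM2l// (nrm_coord J).
Qed.

Lemma scaleB a J J' : scale a J - scale a J' = scale a (J - J').
Proof. by apply/funext => b; rewrite !fctE /scale mulrBr. Qed.

Lemma Lip_ln_pfun a : Lip (fun J => ln (pfun (scale a J))).
Proof.
exists (nrm a); first exact: nrm_ge0.
by move=> J J'; rewrite (le_trans (ln_pfun_lip _ _))// scaleB nrm_scale.
Qed.

Lemma Lip_bond_mean a b : Lip (fun J => bond_mean b (scale a J)).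
Proof.
exists (4 * nrm a); first by rewrite mulr_ge0// nrm_ge0.
move=> J J'; rewrite (le_trans (bond_mean_lip _ _ _))// scaleB -mulrA.
by rewrite ler_wpM2l// nrm_scale.
Qed.

Lemma PL_bond_mean_sqr a b : PL (fun J => bond_mean b (scale a J) ^+ 2).
Proof.
under eq_fun do rewrite expr2.
by apply: PL_mul; exact: Lip_bond_mean.
Qed.

Lemma bond_mean_sqr_le1 b y : bond_mean b y ^+ 2 <= 1.
Proof. by rewrite -(real_normK (num_real _)) expr_le1// bond_mean_norm. Qed.

(** [P] and [Q] are the total weights of the states with [h s b] equal to 1 and -1, the term of [b]
    being removed from the potential; [(1 + h s b) / 2] and [(1 - h s b) / 2] are the indicators.
    The dependence on one coupling thus becomes explicit and can be differentiated. *)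
Lemma bond_mean_updE a b J : exists P Q : R, forall x,
  0 < expR (a b * x) * P + expR (- (a b * x)) * Q /\
  bond_mean b (scale a (upd J b x)) =
    (expR (a b * x) * P - expR (- (a b * x)) * Q) /
    (expR (a b * x) * P + expR (- (a b * x)) * Q).
Proof.
pose r s := \sum_(c | c != b) a c * J c * h s c.
exists (\sum_s (1 + h s b) / 2 * expR (r s)), (\sum_s (1 - h s b) / 2 * expR (r s)).
move=> x.
have potE s : expR (pot (scale a (upd J b x)) s) =
  expR (a b * x) * ((1 + h s b) / 2 * expR (r s)) +
  expR (- (a b * x)) * ((1 - h s b) / 2 * expR (r s)).
  have -> : pot (scale a (upd J b x)) s = a b * x * h s b + r s.
    rewrite /pot (bigD1 b)//= /scale /upd eqxx; congr (_ + _).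
    by apply: eq_bigr => c /negbTE ->.
  rewrite expRD.
  have : (h s b - 1) * (h s b + 1) = 0 by rewrite -subr_sqr h2 expr1n subrr.
  move/eqP; rewrite mulf_eq0 subr_eq0 addr_eq0 => /orP[] /eqP ->.
    by rewrite mulr1; field.
  by rewrite mulrN1; field.
have ZE : pfun (scale a (upd J b x)) =
    expR (a b * x) * (\sum_s (1 + h s b) / 2 * expR (r s)) +
    expR (- (a b * x)) * (\sum_s (1 - h s b) / 2 * expR (r s)).
  by rewrite /pfun !mulr_sumr -big_split /=; apply: eq_bigr => s _; rewrite potE.
rewrite -ZE; split; first exact: pfun_gt0.
rewrite /bond_mean; congr (_ / _).
rewrite !mulr_sumr -sumrB; apply: eq_bigr => s _; rewrite potE.
have := h2 s b; set u := h s b; rewrite expr2 => uu.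
have hp : u * ((1 + u) / 2) = (1 + u) / 2 by lra.
have hm : u * ((1 - u) / 2) = - ((1 - u) / 2) by lra.
rewrite [LHS](_ : _ = expR (a b * x) * (u * ((1 + u) / 2)) * expR (r s) +
  expR (- (a b * x)) * (u * ((1 - u) / 2)) * expR (r s)); last by ring.
by rewrite hp hm; ring.
Qed.

Lemma is_derive_bond_mean a b J (x : R) :
  is_derive x (1 : R) (fun x => bond_mean b (scale a (upd J b x)))
    (a b * (1 - bond_mean b (scale a (upd J b x)) ^+ 2)).
Proof.
have [P [Q PQ]] := bond_mean_updE a b J.
have [Z0 mE] := PQ x; rewrite mE.
have -> : (fun x => bond_mean b (scale a (upd J b x))) = (fun x =>
   (expR (a b * x) * P - expR (- (a b * x)) * Q) /
    (expR (a b * x) * P + expR (- (a b * x)) * Q)).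
  by apply/funext => z; have [_ ->] := PQ z.
have Z1 := lt0r_neq0 Z0.
have ? : is_derive x (1 : R)
    (fun x => (expR (a b * x) * P + expR (- (a b * x)) * Q)^-1)
    (- ((expR (a b * x) * P + expR (- (a b * x)) * Q) ^- 2) *: 
       (a b * (expR (a b * x) * P - expR (- (a b * x)) * Q))).
  apply: is_deriveV => //.
  apply: is_derive_eq; rewrite /GRing.scale /=; ring.
apply: is_derive_eq; rewrite /GRing.scale /=; field.
exact: Z1.
Qed.

Lemma Av_ibp a b : Av (fun J => J b * bond_mean b (scale a J)) =
  a b * (1 - Av (fun J => bond_mean b (scale a J) ^+ 2)).
Proof.
have pm := PL_bond_mean_sqr a b.
have -> : a b * (1 - Av (fun J => bond_mean b (scale a J) ^+ 2)) =
   Av (fun J => a b * (1 - bond_mean b (scale a J) ^+ 2)).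
  rewrite Av_scale; last by apply: PL_add; [exact: PL_cst|exact: PL_opp].
  by rewrite Av_sub ?Av_cst//; exact: PL_cst.
apply: (@Av_partial _ _ _ _ b).
- by apply: PL_mul; [exact: Lip_coord|exact: Lip_bond_mean].
- by apply: PL_scale; apply: PL_add; [exact: PL_cst|exact: PL_opp].
move=> J; under eq_Rintegral do rewrite {1}/upd eqxx.
apply: (@gauss_ibp _ _ _ (1 + `|a b|)).
- exact: is_derive_bond_mean.
- apply: PL1_continuous; apply: PL1Z; apply: PL1B; first exact: PL1_cst.
  exact: (PL_PL1 J b pm).
- by move=> x; rewrite (le_trans (bond_mean_norm _ _))// lerDl.
- move=> x; rewrite normrM (@le_trans _ _ (`|a b| * 1))//; last by rewrite mulr1 lerDr.
  rewrite ler_wpM2l// ger0_norm ?subr_ge0 ?bond_mean_sqr_le1//.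
  by rewrite gerBl sqr_ge0.
Qed.

End Gibbs.

(** * Interpolation *)

(** The tangent inequalities at [x] and at [d + x] give [d * k x <= f (d + x) - f x <= d * k (d +
    x)]. For either sign of [d] the quotient lies between [k x] and [k (d + x)], which merge by
    continuity. *)
Lemma subgrad_is_derive (R : realType) (f k : R -> R) : continuous k ->
  (forall u v, (v - u) * k u <= f v - f u) -> forall x : R, is_derive x (1 : R) f (k x).
Proof.
move=> ck sub x.
have cv : e^-1 *: (f (e *: 1 + x) - f x) @[e --> (0 : R)^'] --> k x.
  apply/cvgrPdist_le => /= e e0.
  have /cvgrPdist_le/(_ _ e0) hk : k (d + x) @[d --> (0 : R)^'] --> k x.
    apply: cvg_within_filter.
    have : (fun d => k (d + x)) d @[d --> (0:R)] --> k (0 + x); last by rewrite add0r.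
    apply: (@cvg_comp _ _ _ (fun d : R => d + x) k _ (nbhs (0 + x))); last exact: ck.
    by apply: cvgD; [exact: cvg_id|exact: cvg_cst].
  near=> d.
  have d0 : d != 0 by near: d; exact: nbhs_dnbhs_neq.
  have hd : `|k x - k (d + x)| <= e by near: d.
  rewrite /GRing.scale /= mulr1.
  have h1 := sub x (d + x); have h2 := sub (d + x) x.
  rewrite addrK in h1.
  have d0' : 0 < `|d| by rewrite normr_gt0.
  rewrite (_ : k x - _ = d^-1 * (d * k x - (f (d + x) - f x))); last by field.
  rewrite normrM normfV ler_pdivrMl// distrC.
  apply: (@le_trans _ _ (`|d| * `|k x - k (d + x)|)); last by rewrite ler_wpM2l.
  rewrite ger0_norm; last by rewrite subr_ge0.
  apply: (@le_trans _ _ (d * (k (d + x) - k x))); last first.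
    by rewrite distrC -normrM ler_norm.
  have : (x - (d + x)) * k (d + x) = - (d * k (d + x)) by ring.
  by rewrite mulrBr; lra.
apply: DeriveDef; first by apply/cvg_ex; exists (k x).
exact/cvg_lim.
Unshelve. all: by end_near. Qed.

Section Interpolation.
Variables (R : realType) (S B : finType) (h : S -> B -> R) (s0 : S) (C : pred B).
Hypothesis h2 : forall s b, h s b ^+ 2 = 1.
Local Notation mu := (@lebesgue_measure R).

Definition wgt (u : R) (b : B) : R := if C b then u else 1.
Definition press u := Av (fun J : B -> R => ln (pfun h (scale (wgt u) J))).
(** The squared bond mean is the Gibbs average of [h s b * h tau b] over two independent replicas,
    so this is one minus the quenched overlap of [b]. *)
Definition overlap_defect u b := 1 - Av (fun J : B -> R => bond_mean h b (scale (wgt u) J) ^+ 2).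
(** The derivative of the pressure in [t = u ^+ 2]; the derivative in [u] carries a further factor
    [2 * u]. *)
Definition dpress u := 2^-1 * \sum_(b | C b) overlap_defect u b.

Let PLm u b : PL (fun J => bond_mean h b (scale (wgt u) J) ^+ 2).
Proof. exact: PL_bond_mean_sqr. Qed.

Lemma overlap_defect_ge0 u b : 0 <= overlap_defect u b.
Proof.
rewrite subr_ge0 -[X in _ <= X](@Av_cst R B); apply: Av_le => //; first exact: PL_cst.
by move=> J; exact: (bond_mean_sqr_le1 s0).
Qed.

Lemma overlap_defect_le1 u b : overlap_defect u b <= 1.
Proof.
rewrite gerBl -[X in X <= _](@Av_cst R B); apply: Av_le => //; first exact: PL_cst.
by move=> J; rewrite sqr_ge0.
Qed.

Lemma wgt_dist u v J : nrm (scale (wgt u) J - scale (wgt v) J) <= `|u - v| * nrm J.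
Proof.
rewrite /nrm mulr_sumr; apply: ler_sum => b _.
rewrite !fctE /scale -mulrBl normrM ler_wpM2r// /wgt.
by case: ifP => // _; rewrite subrr normr0.
Qed.

Lemma overlap_defect_lip b : exists K, forall u v, `|overlap_defect u b - overlap_defect v b| <= K * `|u - v|.
Proof.
exists (8 * Av (@nrm R B)) => u v.
have -> : 8 * Av (@nrm R B) * `|u - v| = Av (fun J : B -> R => (8 * `|u - v|) * nrm J).
  by rewrite Av_scale; [ring|apply/Lip_PL/Lip_nrm].
rewrite (_ : overlap_defect u b - _ = Av (fun J => bond_mean h b (scale (wgt v) J) ^+ 2)
  - Av (fun J => bond_mean h b (scale (wgt u) J) ^+ 2)); last by rewrite /overlap_defect; ring.
apply: Av_dist_le => //; first by apply: PL_scale; exact/Lip_PL/Lip_nrm.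
move=> J; rewrite subr_sqr normrM.
have n1 := bond_mean_norm s0 h2 b (scale (wgt v) J).
have n2 := bond_mean_norm s0 h2 b (scale (wgt u) J).
have n3 := bond_mean_lip s0 h2 b (scale (wgt v) J) (scale (wgt u) J).
have n4 := wgt_dist v u J.
rewrite distrC in n4.
(* In the factored difference of squares, 4 is the Lipschitz constant of the bond mean and 2 bounds
   the sum of two bond means. *)
apply: (@le_trans _ _ ((4 * (`|u - v| * nrm J)) * 2)).
  apply: ler_pM => //; first by apply: (le_trans n3); rewrite ler_wpM2l.
  by rewrite (le_trans (ler_normD _ _))// lerD.
by rewrite le_eqVlt; apply/orP; left; apply/eqP; ring.
Qed.

Lemma lip_continuous (f : R -> R) :
  (exists K, forall u v, `|f u - f v| <= K * `|u - v|) -> continuous f.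
Proof.
move=> [K hK]; apply: PL1_continuous; exists `|K| => x y.
rewrite (le_trans (hK x y))// ler_wpM2r// (le_trans (ler_norm _))//.
by rewrite ler_peMr// -addrA lerDl addr_ge0.
Qed.

Lemma continuous_overlap_defect b : continuous (overlap_defect ^~ b).
Proof. exact/lip_continuous/overlap_defect_lip. Qed.

Lemma continuous_dpress : continuous dpress.
Proof.
move=> x; apply: cvgM; first exact: cvg_cst.
elim: (index_enum B) => [|b r IH].
  by under eq_fun do rewrite big_nil; rewrite big_nil; exact: cvg_cst.
under eq_fun do rewrite big_cons; rewrite big_cons.
by case: (C b) => //; apply: cvgD => //; exact: continuous_overlap_defect.
Qed.

Lemma press_subgrad u v : (v - u) * (2 * u * dpress u) <= press v - press u.
Proof.
have pln w : PL (fun J => ln (pfun h (scale (wgt w) J))).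
  exact/Lip_PL/(Lip_ln_pfun s0).
have pm b : PL (fun J : B -> R => J b * bond_mean h b (scale (wgt u) J)).
  by apply: PL_mul; [exact: Lip_coord|exact: (Lip_bond_mean s0)].
rewrite /press -Av_sub//.
apply: (@le_trans _ _ (Av (fun J : B -> R =>
   \sum_b (wgt v b - wgt u b) * (J b * bond_mean h b (scale (wgt u) J))))).
  rewrite Av_sum; last by move=> b _; exact: PL_scale.
  under eq_bigr do rewrite Av_scale// Av_ibp// -/(overlap_defect _ _).
  rewrite (bigID C) /= [X in _ <= _ + X]big1 ?addr0; last first.
    by move=> b /negbTE Cb; rewrite /wgt Cb subrr mul0r.
  rewrite [leLHS](_ : _ = (v - u) * u * \sum_(b | C b) overlap_defect u b); last first.
    by rewrite /dpress; field.
  rewrite mulr_sumr le_eqVlt.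
  apply/orP; left; apply/eqP; by apply: eq_bigr => b Cb; rewrite /overlap_defect /wgt Cb; ring.
apply: Av_le.
- by apply: PL_sum => b _; exact: PL_scale.
- by apply: PL_add => //; exact: PL_opp.
move=> J.
apply: le_trans (@ln_pfun_subgrad _ _ _ h s0 (scale (wgt u) J) (scale (wgt v) J)).
apply: ler_sum => b _; rewrite le_eqVlt; apply/orP; left; apply/eqP.
by rewrite /scale; ring.
Qed.

Lemma is_derive_press (u : R) : is_derive u (1 : R) press (2 * u * dpress u).
Proof.
apply: (@subgrad_is_derive _ press (fun u => 2 * u * dpress u)).
  move=> x; apply: cvgM; last exact: continuous_dpress.
  by apply: cvgM; [exact: cvg_cst|exact: cvg_id].
exact: press_subgrad.
Qed.

Theorem press_interpolation :
  press 1 - press 0 = \int[mu]_(t in `[(0 : R), 1]) dpress (Num.sqrt t).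
Proof.
have cp : continuous press.
  move=> x; apply: differentiable_continuous; apply/derivable1_diffP.
  by have := is_derive_press x; case.
have cps : continuous (press \o Num.sqrt).
  by move=> x; apply: continuous_comp; [exact: sqrt_continuous|exact: cp].
have cds : continuous (dpress \o Num.sqrt).
  by move=> x; apply: continuous_comp; [exact: sqrt_continuous|exact: continuous_dpress].
(* The factor [2 * Num.sqrt t] cancels against the derivative of the square root. Only [t > 0] is
   treated: at the endpoints the fundamental theorem asks for one-sided continuity. *)
have ds (t : R) : 0 < t -> is_derive t (1 : R) (press \o Num.sqrt) (dpress (Num.sqrt t)).
  move=> t0; have h1 := is_derive1_sqrt t0; have h3 := is_derive_press (Num.sqrt t).
  have := is_derive1_comp h3 h1.
  congr is_derive.
  by rewrite /GRing.scale /=; field; rewrite gt_eqF// sqrtr_gt0.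
rewrite /Rintegral (@continuous_FTC2 _ (dpress \o Num.sqrt) (press \o Num.sqrt)) //=.
- by rewrite sqrtr1 sqrtr0.
- exact: continuous_subspaceT.
- split => [t| |].
  + by rewrite in_itv/= => /andP[t0 _]; case: (ds t t0).
  + by apply: cvg_at_right_filter; exact: cps.
  + by apply: cvg_at_left_filter; exact: cps.
- by move=> t; rewrite in_itv/= => /andP[t0 _]; rewrite derive1E; have := ds t t0; case.
Qed.

Lemma dpress_integrable : mu.-integrable `[(0 : R), 1] (EFin \o (dpress \o Num.sqrt)).
Proof.
apply: continuous_compact_integrable; first exact: segment_compact.
apply: continuous_subspaceT => x.
by apply: continuous_comp; [exact: sqrt_continuous|exact: continuous_dpress].
Qed.

Lemma dpress_ge0 u : 0 <= dpress u.
Proof. by rewrite mulr_ge0// sumr_ge0// => b _; exact: overlap_defect_ge0. Qed.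

Lemma dpress_le u : dpress u <= #|C|%:R / 2.
Proof.
rewrite /dpress [leRHS]mulrC ler_wpM2l// -sumr_const; apply: ler_sum => b _; exact: overlap_defect_le1.
Qed.

(** Used twice: with the bonds between blocks it confines [Iint] to the unit interval, and with the
    wrapping bonds of a single box it compares the free box with its torus. *)
Lemma press_diff_bounds : 0 <= press 1 - press 0 <= #|C|%:R / 2.
Proof.
rewrite press_interpolation; apply/andP; split.
  by apply: Rintegral_ge0 => t _; exact: dpress_ge0.
apply: (@le_trans _ _ (\int[mu]_(t in `[(0 : R), 1]) (#|C|%:R / 2))).
  apply: le_Rintegral => //; first exact: dpress_integrable.
    apply: continuous_compact_integrable; first exact: segment_compact.
    by apply: continuous_subspaceT => x; exact: cvg_cst.
  by move=> t _; exact: dpress_le.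
have m1 : mu `[(0 : R), 1]%classic = 1%E.
  by rewrite lebesgue_measure_itv/= lte_fin ltr01 oppr0 adde0.
rewrite le_eqVlt; apply/orP; left; apply/eqP.
by transitivity (#|C|%:R / 2 * fine (mu `[(0 : R), 1]%classic));
  [exact: Rintegral_cst|rewrite m1 /= mulr1].
Qed.

End Interpolation.

(** * Block decomposition of the torus *)

Section Symmetry.
Variables (R : realType) (S B : finType) (h : S -> B -> R) (s0 : S).
Hypothesis h2 : forall s b, h s b ^+ 2 = 1.
Variables (C : pred B) (rho : B -> B) (eta : S -> S).
Hypotheses (rho_inj : injective rho) (eta_inj : injective eta).
Hypothesis h_eta : forall s b, h (eta s) b = h s (rho b).
Hypothesis C_rho : forall b, C (rho b) = C b.

Lemma pot_sym (y : B -> R) s : pot h (y \o rho) (eta s) = pot h y s.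
Proof.
rewrite [RHS](reindex_inj rho_inj) /=.
by apply: eq_bigr => b _; rewrite h_eta.
Qed.

Lemma bond_mean_sym (y : B -> R) b : bond_mean h (rho b) y = bond_mean h b (y \o rho).
Proof.
rewrite /bond_mean /pfun; congr (_ / _).
  rewrite [RHS](reindex_inj eta_inj) /=.
  by apply: eq_bigr => s _; rewrite pot_sym h_eta.
rewrite [RHS](reindex_inj eta_inj) /=.
by apply: eq_bigr => s _; rewrite pot_sym.
Qed.

(** Renaming the couplings by [rho] preserves their joint law, and [eta] carries the Gibbs measure
    along. *)
Lemma overlap_defect_sym u b : overlap_defect h C u (rho b) = overlap_defect h C u b.
Proof.
congr (1 - _).
rewrite -(Av_reindex rho_inj (PL_bond_mean_sqr s0 h2 (wgt C u) b)).
apply: Av_eq => J; rewrite bond_mean_sym; congr (bond_mean h b _ ^+ 2).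
by apply/funext => c; rewrite /scale /= /wgt C_rho.
Qed.

End Symmetry.

(** * Block coordinates and translations on the magnified torus *)

Section Blocks.
Variables (R : realType) (d k : nat) (L : 'I_d -> nat).
Hypothesis L0 : forall i, (0 < L i)%N.
Notation M := (mag k.+1 L).
Definition block := {ffun 'I_d -> 'I_k.+1}.
Implicit Types (s : block) (l : site L) (n : site M).

Lemma embed_subproof s l j : (s j * L j + l j < k.+1 * L j)%N.
Proof.
have := ltn_ord (l j); have := ltn_ord (s j) => h1 h2.
apply: (@leq_trans ((s j).+1 * L j)); last by rewrite leq_mul2r h1 orbT.
by rewrite mulSn addnC ltn_add2r.
Qed.

(** Euclidean division by [L j] in each coordinate: the quotient is the block, the remainder the
    site within it. The magnification factor is [k.+1], so the type of blocks is inhabited. *)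
Definition embed s l : site M := [ffun j => Ordinal (embed_subproof s l j)].

Definition block_of n : block := [ffun j => inord (n j %/ L j)%N].

Definition local_of n : site L := [ffun j => Ordinal (ltn_pmod (n j) (L0 j))].

Lemma embedE s l j : embed s l j = (s j * L j + l j)%N :> nat.
Proof. by rewrite ffunE. Qed.

Lemma block_embed s l : block_of (embed s l) = s.
Proof.
apply/ffunP => j; rewrite ffunE embedE divnMDl// divn_small// addn0.
by rewrite inord_val.
Qed.

Lemma local_embed s l : local_of (embed s l) = l.
Proof.
apply/ffunP => j; apply: val_inj.
by rewrite ffunE /= embedE modnMDl modn_small.
Qed.

Lemma embed_local n : embed (block_of n) (local_of n) = n.
Proof.
apply/ffunP => j; apply: val_inj.
rewrite /= embedE !ffunE /= inordK -?divn_eq//.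
by rewrite ltn_divLR//; exact: ltn_ord.
Qed.

Definition embed_bond s (b : bond L) : bond M := (embed s b.1, b.2).

Lemma embed_bond_inj s : injective (embed_bond s).
Proof.
move=> [l i] [l' i'] [e ->]; congr (_, _).
by have := congr1 local_of e; rewrite !local_embed.
Qed.

Lemma big_embed_bond (P : pred (bond M)) (F : bond M -> R) :
  \sum_(b | P b) F b = \sum_s \sum_(b : bond L | P (embed_bond s b)) F (embed_bond s b).
Proof.
rewrite pair_big_dep /=.
rewrite (reindex (fun p : block * bond L => embed_bond p.1 p.2)) //=.
exists (fun b : bond M => (block_of b.1, (local_of b.1, b.2))) => [[s [l i]]|[n i]] _ /=.
  by rewrite /embed_bond /= block_embed local_embed.
by rewrite /embed_bond /= embed_local.
Qed.

Lemma cut_embed_bond s b : cut_bond (embed_bond s b) = ~~ free_bond b.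
Proof.
case: b => l i; rewrite /cut_bond /free_bond /= embedE -addnS modnMDl -leqNgt.
have := ltn_ord (l i); rewrite leq_eqVlt => /orP[/eqP ->|h].
  by rewrite modnn eqxx leqnn.
by rewrite modn_small//= leqNgt h.
Qed.

Lemma shift_embed s b : free_bond b -> Pilot.Defs.shift (embed s b.1) b.2 = embed s (Pilot.Defs.shift b.1 b.2).
Proof.
case: b => l i; rewrite /free_bond /= => h.
apply/ffunP => j; apply: val_inj; rewrite ffunE /= !embedE ffunE /=.
have lt : (l j + (j == i) < L j)%N.
  by case: eqP => [->|_]; rewrite ?addn1 ?addn0.
rewrite (modn_small lt) -addnA modn_small//.
have := ltn_ord (s j) => h1.
apply: (@leq_trans ((s j).+1 * L j)); last by rewrite leq_mul2r h1 orbT.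
by rewrite mulSn addnC ltn_add2r.
Qed.

Lemma translate_subproof s n j : ((n j + s j * L j) %% M j < M j)%N.
Proof. by rewrite ltn_mod; exact: site_pos n j. Qed.

(** A cyclic shift by whole blocks: it carries block 0 to block [s] and, as [L j] divides [M j],
    maps cut bonds to cut bonds. *)
Definition translate s n : site M := [ffun j => Ordinal (translate_subproof s n j)].

Lemma translateE s n j : translate s n j = ((n j + s j * L j) %% M j)%N :> nat.
Proof. by rewrite ffunE. Qed.

Lemma translate_inj s : injective (translate s).
Proof.
move=> n n' e; apply/ffunP => j; apply: val_inj => /=.
have : (n j + s j * L j == n' j + s j * L j %[mod M j])%N by rewrite -!translateE e.
by rewrite eqn_modDr !modn_small// => /eqP.
Qed.

Lemma translate_shift s n i : translate s (Pilot.Defs.shift n i) = Pilot.Defs.shift (translate s n) i.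
Proof.
apply/ffunP => j; apply: val_inj; rewrite /= translateE !ffunE /= !modnDml.
by rewrite addnAC.
Qed.

Definition translate_bond s (b : bond M) : bond M := (translate s b.1, b.2).

Lemma translate_bond_inj s : injective (translate_bond s).
Proof. by move=> [n i] [n' i'] [e ->]; congr (_, _); apply: (@translate_inj s). Qed.

Lemma cut_translate_bond s b : cut_bond (translate_bond s b) = cut_bond b.
Proof.
case: b => n i; rewrite /cut_bond /= translateE.
rewrite -addn1 -modnDml modn_dvdm ?dvdn_mull//.
by rewrite [X in (X %% _ + 1)%N]addnC modnMDl modnDml addn1.
Qed.

Definition block0 : block := [ffun=> ord0].

Lemma translate_embed0 s l : translate s (embed block0 l) = embed s l.
Proof.
apply/ffunP => j; apply: val_inj; rewrite /= translateE !embedE ffunE /= add0n addnC.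
by rewrite modn_small// embed_subproof.
Qed.

Lemma translate_bond_embed_bond0 s b : translate_bond s (embed_bond block0 b) = embed_bond s b.
Proof. by rewrite /translate_bond /embed_bond /= translate_embed0. Qed.

(** In block 0 global and local coordinates coincide, and among the values below [L i] only
    [(L i).-1] fails [free_bond]. *)
Lemma bdry_embed_bond s b : bdry_bond (embed_bond s b) = (s == block0) && ~~ free_bond b.
Proof.
case: b => l i; rewrite /bdry_bond /free_bond /=.
have -> : [forall j, (embed s l j < L j)%N] = (s == block0).
  apply/forallP/eqP => [h|-> j]; last by rewrite embedE ffunE /= mul0n add0n ltn_ord.
  apply/ffunP => j; apply: val_inj; rewrite ffunE /=.
  have := h j; rewrite embedE; case: (nat_of_ord (s j)) => // m.
  by rewrite mulSn -addnA ltnNge leq_addr.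
case: eqP => //= ->; rewrite embedE ffunE /= mul0n add0n -leqNgt.
by have := ltn_ord (l i); have := L0 i; lia.
Qed.

End Blocks.

(** * The free box and its surface *)

Section FreeBox.
Variables (R : realType) (d : nat) (L : 'I_d -> nat).

Lemma sigb_sqr (s : conf L) (b : bond L) : sigb R s b ^+ 2 = 1.
Proof.
have spin2 x : spin R x ^+ 2 = 1 by case: x; rewrite /spin ?sqrrN expr1n.
by rewrite exprMn !spin2 mulr1.
Qed.

Lemma pot_wgt0 (C : pred (bond L)) (J : bond L -> R) s :
  pot (@sigb R d L) (scale (wgt C 0) J) s = \sum_(b | ~~ C b) J b * sigb R s b.
Proof.
rewrite [RHS]big_mkcond /=; apply: eq_bigr => b _; rewrite /scale /wgt.
by case: (C b); rewrite ?mul0r ?mul1r.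
Qed.

(** Weight 0 on the wrapping bonds opens the torus, so the free pressure is the [u = 0] end of an
    interpolation on the torus of the box itself. *)
Lemma ZfreeE (J : bond L -> R) :
  Zfree J = pfun (@sigb R d L) (scale (wgt (predC (@free_bond d L)) 0) J).
Proof.
apply: eq_bigr => s _; rewrite pot_wgt0; congr expR.
by apply: eq_bigl => b /=; rewrite negbK.
Qed.

Lemma PfreeE : Pfree R L = press (@sigb R d L) (predC (@free_bond d L)) 0.
Proof. by apply: Av_eq => J; rewrite ZfreeE. Qed.

Lemma Zfree_gt0 (J : bond L -> R) : 0 < Zfree J.
Proof. by rewrite ZfreeE; apply: pfun_gt0; exact: [ffun=> true]. Qed.

Lemma PL_ln_Zfree : PL (fun J : bond L -> R => ln (Zfree J)).
Proof.
have -> : (fun J : bond L -> R => ln (Zfree J)) = (fun J => ln (pfun (@sigb R d L)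
    (scale (wgt (predC (@free_bond d L)) 0) J))).
  by apply/funext => J; rewrite ZfreeE.
by apply/Lip_PL/Lip_ln_pfun; [exact: [ffun=> true]|exact: sigb_sqr].
Qed.

(** The non-free bonds of direction [i] start on the face where coordinate [i] is maximal: one value
    is allowed at [i] and all values elsewhere. *)
Lemma card_nonfree (L0 : forall i, (0 < L i)%N) :
  #|[pred b : bond L | ~~ free_bond b]| =
  (\sum_(i < d) \prod_(j < d | j != i) L j)%N.
Proof.
rewrite -sum1_card.
rewrite (eq_bigl (fun b : bond L => true && ~~ free_bond (b.1, b.2))); last by case.
rewrite -(pair_big_dep xpredT (fun n i => ~~ free_bond (n, i)) (fun _ _ => 1%N)) /=.
rewrite (exchange_big_dep xpredT) //=; apply: eq_bigr => i _.
rewrite sum1_card.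
pose F (j : 'I_d) : pred 'I_(L j) := [pred x : 'I_(L j) | (j == i) ==> (x.+1 == L j)].
have -> : #|[pred n : site L | ~~ free_bond (n, i)]| = #|(family F : simpl_pred (site L))|.
  apply: eq_card => n; rewrite !inE /free_bond /= -leqNgt.
  apply/idP/forallP => [h j|/(_ i)]; rewrite inE; last first.
    by rewrite eqxx /= => /eqP ->.
  apply/implyP => /eqP ->; rewrite eqn_leq h andbT; exact: ltn_ord.
rewrite (@card_family _ (fun j => 'I_(L j))) foldrE big_map big_enum /= (bigD1 i)//=.
rewrite (_ : #|F i| = 1%N) ?mul1n.
  apply: eq_bigr => j ji; rewrite -[RHS]card_ord; apply: eq_card => x.
  by rewrite !inE (negbTE ji).
have h : ((L i).-1 < L i)%N by rewrite prednK.
rewrite -(card1 (Ordinal h)); apply: eq_card => x; rewrite !inE eqxx /=.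
by have := L0 i; rewrite -val_eqE /=; lia.
Qed.

Lemma surfE (L0 : forall i, (0 < L i)%N) :
  surf R L = 2 * #|[pred b : bond L | ~~ free_bond b]|%:R.
Proof.
rewrite card_nonfree// natr_sum; congr (_ * _); apply: eq_bigr => i _.
by rewrite natr_prod.
Qed.

End FreeBox.

(** * Pressure and overlaps on the magnified torus *)

Section Torus.
Variables (R : realType) (d k : nat) (L : 'I_d -> nat).
Hypothesis L0 : forall i, (0 < L i)%N.
Notation M := (mag k.+1 L).
Notation hM := (@sigb R d M).
Notation cut := (@cut_bond d k.+1 L).
Notation mu := (@lebesgue_measure R).

Definition pull (s : block d k) (sigma : conf M) : conf L :=
  [ffun l => sigma (embed s l)].

Lemma sigb_pull s (sigma : conf M) (b : bond L) : free_bond b ->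
  hM sigma (embed_bond s b) = sigb R (pull s sigma) b.
Proof. by move=> fb; rewrite /sigb /embed_bond /= shift_embed// !ffunE. Qed.

(** A torus configuration is the same as a family of block configurations, [glue] being inverse to
    restriction, so distributivity factors the sum. *)
Lemma big_conf_blocks (G : block d k -> conf L -> R) :
  \sum_(sigma : conf M) \prod_s G s (pull s sigma) = \prod_s \sum_(sg : conf L) G s sg.
Proof.
rewrite bigA_distr_bigA /=.
pose glue (f : {ffun block d k -> conf L}) : conf M :=
  [ffun n => f (block_of n) (local_of L0 n)].
rewrite (reindex glue) /=.
  apply: eq_bigr => f _; apply: eq_bigr => s _; congr (G s).
  by apply/ffunP => l; rewrite !ffunE (block_embed L0) local_embed.
exists (fun sigma => [ffun s => pull s sigma]) => [f|sigma] _.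
  apply/ffunP => s; rewrite ffunE; apply/ffunP => l.
  by rewrite !ffunE (block_embed L0) local_embed.
by apply/ffunP => n; rewrite !ffunE embed_local.
Qed.

Lemma pfun_uncoupled (J : bond M -> R) :
  pfun hM (scale (wgt cut 0) J) = \prod_s Zfree (J \o embed_bond s).
Proof.
rewrite /Zfree -big_conf_blocks; apply: eq_bigr => sigma _.
rewrite pot_wgt0 (big_embed_bond L0) -expR_sum /=; congr expR.
apply: eq_bigr => s _; apply: eq_big => b; first by rewrite cut_embed_bond// negbK.
by rewrite cut_embed_bond// negbK => fb; rewrite sigb_pull.
Qed.

Lemma card_block : #|block d k| = (k.+1 ^ d)%N.
Proof. by rewrite card_ffun !card_ord. Qed.

Lemma press_uncoupled : press hM cut 0 = (k.+1 ^ d)%:R * Pfree R L.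
Proof.
rewrite -card_block mulr_natl -sumr_const.
transitivity (Av (fun J : bond M -> R => \sum_s ln (Zfree (J \o embed_bond s)))).
  apply: Av_eq => J; rewrite pfun_uncoupled.
  (* Positivity is carried through the induction because [lnM] splits the logarithm of positive
     factors. *)
  suff : forall r : seq (block d k), 0 < \prod_(s <- r) Zfree (J \o embed_bond s) /\
    ln (\prod_(s <- r) Zfree (J \o embed_bond s)) = \sum_(s <- r) ln (Zfree (J \o embed_bond s)).
    by move=> h; have [_] := h (index_enum (block d k)).
  elim=> [|s r [IH1 IH2]]; first by rewrite !big_nil ln1.
  have z := Zfree_gt0 (J \o embed_bond s).
  by rewrite !big_cons mulr_gt0// lnM ?posrE// IH2.
have pz s : PL (fun J : bond M -> R => ln (Zfree (J \o embed_bond s))).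
  exact: (PL_comp (@embed_bond_inj d k L L0 s) (@PL_ln_Zfree R d L)).
rewrite Av_sum//; apply: eq_bigr => s _.
exact: (Av_reindex (@embed_bond_inj d k L L0 s) (@PL_ln_Zfree R d L)).
Qed.

Lemma big_bdry (F : bond M -> R) :
  \sum_(b | bdry_bond b) F b = \sum_(b : bond L | ~~ free_bond b) F (embed_bond (block0 d k) b).
Proof.
rewrite (big_embed_bond L0) (bigD1 (block0 d k))//= [X in _ + X]big1 ?addr0.
  by apply: eq_bigl => b; rewrite bdry_embed_bond// eqxx.
by move=> s /negbTE s0; apply: big_pred0 => b; rewrite bdry_embed_bond// s0.
Qed.

Lemma card_bdry :
  #|[pred b : bond M | bdry_bond b]|%:R = #|[pred b : bond L | ~~ free_bond b]|%:R :> R.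
Proof.
by have := big_bdry (fun=> 1); rewrite !sumr_const.
Qed.

Lemma overlap_defect_block u s (b : bond L) :
  overlap_defect hM cut u (embed_bond s b) = overlap_defect hM cut u (embed_bond (block0 d k) b).
Proof.
rewrite -(translate_bond_embed_bond0 s b).
apply: (@overlap_defect_sym _ _ _ hM [ffun=> true] _ _ _
  (fun sigma : conf M => [ffun n => sigma (translate s n)])).
- exact: sigb_sqr.
- exact: translate_bond_inj.
- move=> s1 s2 /ffunP e; apply/ffunP => n.
  have [g _ gK] := injF_bij (@translate_inj d k L s).
  by have := e (g n); rewrite !ffunE gK.
- by move=> sg c; rewrite /sigb /translate_bond /= !ffunE translate_shift.
- by move=> c; rewrite cut_translate_bond.
Qed.

Lemma dpress_cut u : dpress hM cut u =
  (k.+1 ^ d)%:R / 2 * \sum_(b | bdry_bond b) overlap_defect hM cut u b.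
Proof.
rewrite /dpress (big_embed_bond L0) big_bdry.
under eq_bigr => s _.
  under eq_bigr do rewrite overlap_defect_block.
  under eq_bigl do rewrite cut_embed_bond//.
  over.
by rewrite sumr_const card_block -mulr_natl; ring.
Qed.

Lemma UtE (t : R) (J : bond M -> R) sigma :
  Ut t J sigma = pot hM (scale (wgt cut (Num.sqrt t)) J) sigma.
Proof.
by apply: eq_bigr => b _; rewrite /scale /wgt; case: ifP => //; rewrite sqrtr1.
Qed.

(** For fixed couplings the two replicas are independent, so the double sum factors bond by bond
    into a square. *)
Lemma omega_qbdry (t : R) (J : bond M -> R) : omega t J (@qbdry R d k.+1 L) =
  \sum_(b | bdry_bond b) #|[pred b : bond M | bdry_bond b]|%:R^-1 *
     bond_mean hM b (scale (wgt cut (Num.sqrt t)) J) ^+ 2.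
Proof.
rewrite /omega; set y := scale _ J; set N := #|_|%:R.
have -> : \sum_(s : conf M) expR (Ut t J s) = pfun hM y.
  by apply: eq_bigr => s _; rewrite UtE.
rewrite -mulr_sumr.
have -> : \sum_(s : conf M) \sum_(tau : conf M)
      qbdry R s tau * expR (Ut t J s + Ut t J tau) =
   N^-1 * \sum_(b | bdry_bond b) (\sum_s hM s b * expR (pot hM y s)) ^+ 2.
  under [in RHS]eq_bigr => b _ do rewrite expr2 mulr_suml.
  rewrite [in RHS]exchange_big /= mulr_sumr; apply: eq_bigr => s _.
  under [in RHS]eq_bigr => b _ do rewrite mulr_sumr.
  rewrite [in RHS]exchange_big /= mulr_sumr; apply: eq_bigr => tau _.
  rewrite /qbdry mulr_suml mulr_suml mulr_sumr; apply: eq_bigr => b _.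
  by rewrite !UtE expRD -/y -/N; ring.
rewrite -mulrA mulr_suml; congr (_ * _); apply: eq_bigr => b _.
by rewrite /bond_mean expr_div_n.
Qed.

Lemma bdry_neq0 : (0 < d)%N -> #|[pred b : bond M | bdry_bond b]|%:R != 0 :> R.
Proof.
move=> d0; rewrite card_bdry card_nonfree// pnatr_eq0 -lt0n.
by rewrite (bigD1 (Ordinal d0))//= ltn_addr//; apply: prodn_gt0.
Qed.

Lemma qstate_defect (t : R) : (0 < d)%N -> 1 - qstate t (@qbdry R d k.+1 L) =
  #|[pred b : bond M | bdry_bond b]|%:R^-1 *
    \sum_(b | bdry_bond b) overlap_defect hM cut (Num.sqrt t) b.
Proof.
move=> d0.
have pm b : PL (fun J : bond M -> R =>
    bond_mean hM b (scale (wgt cut (Num.sqrt t)) J) ^+ 2).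
  by apply: PL_bond_mean_sqr; [exact: [ffun=> true]|exact: sigb_sqr].
set N := #|_|%:R; have N0 : N != 0 by exact: bdry_neq0.
rewrite /qstate (Av_eq (omega_qbdry t)) Av_sum; last by move=> b _; exact: PL_scale.
under eq_bigr => b _ do rewrite Av_scale//.
rewrite -mulr_sumr sumrB sumr_const mulrBr -/N; congr (_ - _).
by rewrite mulVf.
Qed.

Lemma IintE : (0 < d)%N -> press hM cut 1 - press hM cut 0 =
  (k.+1 ^ d)%:R * (surf R L / 4) * Iint R L k.+1.
Proof.
move=> d0; pose c : R := (k.+1 ^ d)%:R * (surf R L / 4).
have cE : c = (k.+1 ^ d)%:R / 2 * #|[pred b : bond M | bdry_bond b]|%:R.
  by rewrite /c surfE// card_bdry; field.
have c0 : c != 0.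
  by rewrite cE !mulf_neq0 ?invr_eq0 ?bdry_neq0// pnatr_eq0 expn_eq0.
(* Dividing by [c] on the left puts the constant inside the integral of [dpress], whose
   integrability is known; what remains is an identity of integrands. *)
rewrite -/c -[LHS](mulVKf c0); congr (_ * _).
have s0 : conf M := [ffun=> true].
rewrite (press_interpolation s0 _ (@sigb_sqr R d M)).
rewrite /Iint -RintegralZl//; last first.
  exact: (dpress_integrable s0 _ (@sigb_sqr R d M)).
apply: eq_Rintegral => t _; rewrite qstate_defect// dpress_cut cE.
by field; rewrite bdry_neq0//= pnatr_eq0 expn_eq0.
Qed.

Lemma press_coupled_bounds :
  0 <= press hM cut 1 - Pfree R M <= surf R M / 4.
Proof.
have s0 : conf M := [ffun=> true].
have M0 i : (0 < M i)%N by rewrite muln_gt0 L0.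
have := press_diff_bounds s0 (predC (@free_bond d M)) (@sigb_sqr R d M).
(* At [u = 1] all weights are 1, so cutting between blocks and cutting only the outer boundary give
   the same full torus. *)
rewrite -PfreeE (_ : press _ _ 1 = press hM cut 1).
  rewrite surfE//; set n := #|_|%:R => h.
  by rewrite (_ : 2 * n / 4 = n / 2)//; field.
apply: Av_eq => J; congr (ln (pfun _ (scale _ J))).
by apply/funext => b; rewrite /wgt !if_same.
Qed.

Lemma volM : vol R M = (k.+1 ^ d)%:R * vol R L.
Proof.
rewrite /vol; under eq_bigr do rewrite natrM.
by rewrite big_split /= prodr_const card_ord natrX.
Qed.

(** Multiplying by [k.+1] expresses the growth of order [d - 1] without subtraction in the
    exponent. *)
Lemma surfM : k.+1%:R * surf R M = (k.+1 ^ d)%:R * surf R L.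
Proof.
rewrite /surf mulrCA [RHS]mulrCA; congr (_ * _).
rewrite !mulr_sumr; apply: eq_bigr => i _.
under eq_bigr do rewrite natrM.
rewrite big_split /= mulrA; congr (_ * _).
rewrite natrX -[in RHS](card_ord d) -prodr_const [RHS](bigD1 i)//=.
Qed.
End Torus.

(** * The surface pressure *)

Section SurfacePressure.
Variables (R : realType) (d : nat) (L : 'I_d -> nat).
Hypotheses (d0 : (0 < d)%N) (L0 : forall i, (0 < L i)%N).

Lemma card_cut k : #|(@cut_bond d k.+1 L)|%:R =
  (k.+1 ^ d)%:R * #|[pred b : bond L | ~~ free_bond b]|%:R :> R.
Proof.
rewrite -[LHS]sumr_const (big_embed_bond L0) -card_block mulr_natl -sumr_const.
apply: eq_bigr => s _; rewrite sumr_const; congr (_ *+ _); apply: eq_card => b.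
exact: cut_embed_bond.
Qed.

Lemma vol_gt0 : 0 < vol R L.
Proof. by rewrite /vol prodr_gt0// => i _; rewrite ltr0n. Qed.

Lemma surf_gt0 : 0 < surf R L.
Proof.
rewrite surfE// card_nonfree// mulr_gt0// ltr0n (bigD1 (Ordinal d0))//=.
by rewrite ltn_addr//; apply: prodn_gt0.
Qed.

Lemma expk_gt0 k : 0 < (k.+1 ^ d)%:R :> R.
Proof. by rewrite ltr0n expn_gt0. Qed.

Lemma Iint_bounds k : 0 <= Iint R L k.+1 <= 1.
Proof.
have s0 : conf (mag k.+1 L) := [ffun=> true].
have := press_diff_bounds s0 (@cut_bond d k.+1 L) (@sigb_sqr R d _).
rewrite (@IintE R d k L L0 d0) card_cut // (_ : _ * _ / 2 = (k.+1 ^ d)%:R * (surf R L / 4) * 1); last first.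
  by rewrite surfE//; field.
have c0 : 0 < (k.+1 ^ d)%:R * (surf R L / 4).
  by rewrite mulr_gt0 ?expk_gt0// divr_gt0// surf_gt0.
by rewrite ler_pM2l// pmulr_rge0.
Qed.

(** The middle term is the torus pressure minus the free pressure of the magnified box, per block:
    the torus pressure is expanded by the interpolation from the uncoupled blocks. By [surfM] the
    surface per block carries the factor [1/(k+1)], which is [harmonic k]. *)
Lemma torus_free_gap k :
  0 <= (Pfree R L + surf R L / 4 * Iint R L k.+1) -
       vol R L * (Pfree R (mag k.+1 L) / vol R (mag k.+1 L)) <=
  surf R L / 4 * harmonic k.
Proof.
have K0 := expk_gt0 k; have K1 := lt0r_neq0 K0.
have := @press_coupled_bounds R d k L L0.
rewrite -(subrK (press (@sigb R d _) (@cut_bond d k.+1 L) 0) (press _ _ 1)).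
rewrite (@IintE R d k L L0 d0) press_uncoupled// => h.
have V0 := lt0r_neq0 vol_gt0.
have kn : k.+1%:R != 0 :> R by rewrite pnatr_eq0.
have sE : surf R (mag k.+1 L) / 4 = (k.+1 ^ d)%:R * (surf R L / 4 * harmonic k).
  apply: (mulfI kn); rewrite [LHS]mulrA surfM /harmonic /=.
  by move: (k.+1%:R) kn => m m0; field.
move: h; rewrite sE [X in 0 <= X <= _](_ : _ = (k.+1 ^ d)%:R *
   (Pfree R L + surf R L / 4 * Iint R L k.+1 -
   vol R L * (Pfree R (mag k.+1 L) / vol R (mag k.+1 L)))).
  by rewrite pmulr_rge0// ler_pM2l.
by rewrite volM; field; rewrite V0 K1.
Qed.

Lemma cvg_Iint p : is_inf_vol_pressure d p ->
  Iint R L k.+1 @[k --> \oo] --> 4 / surf R L * (p * vol R L - Pfree R L).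
Proof.
move=> hp; have S0 := lt0r_neq0 surf_gt0.
pose P k := Pfree R (mag k.+1 L) / vol R (mag k.+1 L).
have cP : P k @[k --> \oo] --> p.
  apply/cvgrPdist_lt => e e0; have [N hN] := hp e e0.
  (* Every side of the magnified box is at least [k.+1] because [L i] is positive, so all sides grow
     together. *)
  exists N => // k /= Nk; rewrite distrC; apply: hN => i.
  by rewrite (leq_trans Nk)// (leq_trans (leqnSn k))// leq_pmulr.
pose g k := Pfree R L + surf R L / 4 * Iint R L k.+1 - vol R L * P k.
have cg : g k @[k --> \oo] --> 0.
  apply: (@squeeze_cvgr _ _ _ _ (cst 0) (fun k => surf R L / 4 * harmonic k)).
  - by apply: nearW => k; exact: torus_free_gap.
  - exact: cvg_cst.
  - rewrite -[X in _ --> X](mulr0 (surf R L / 4)).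
    by apply: cvgM; [exact: cvg_cst|exact: cvg_harmonic].
have -> : (fun k => Iint R L k.+1) =
    (fun k => 4 / surf R L * (g k + (vol R L * P k - Pfree R L))).
  by apply/funext => k; rewrite /g; field.
have -> : p * vol R L - Pfree R L = 0 + (vol R L * p - Pfree R L) by ring.
apply: cvgM; first exact: cvg_cst.
apply: cvgD => //; apply: cvgB; last exact: cvg_cst.
by apply: cvgM => //; exact: cvg_cst.
Qed.

End SurfacePressure.

Unset Implicit Arguments.

Theorem theorem1 (R : realType) (d : nat) (L : 'I_d -> nat) (p : R) :
  (0 < d)%N -> (forall i, (0 < L i)%N) -> is_inf_vol_pressure d p ->
  let T := Pfree R L - p * vol R L in
  (exists l : R, (fun k : nat => Iint R L k.+1) @ \oo --> l
                 /\ T = - (surf R L / 4) * l)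
  /\ (- (1 / 4) <= T / surf R L <= 0).
Proof.
move=> d0 L0 hp T; have S0 := lt0r_neq0 (surf_gt0 R d0 L0).
have cI := cvg_Iint d0 L0 hp.
set l := 4 / surf R L * (p * vol R L - Pfree R L) in cI.
have TE : T = - (surf R L / 4) * l by rewrite /T /l; field.
split; first by exists l.
have -> : T / surf R L = - (l / 4) by rewrite TE; field.
(* The bounds on [l] come from the integrals at finite [k], each of which lies between 0 and 1. *)
have l0 : 0 <= l.
  apply: (cvgr_to_ge cI); apply: nearW => k.
  by have /andP[] := Iint_bounds R d0 L0 k.
have l1 : l <= 1.
  apply: (cvgr_to_le cI); apply: nearW => k.
  by have /andP[] := Iint_bounds R d0 L0 k.
by apply/andP; split; lra.
Qed.
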